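(* Let $\mathcal T$ be a CStree and let $\mathcal C$ be a collection of contexts with associated DAGs $G_{X_C=\mathbf x_C}$, $(X_C=\mathbf x_C)\in\mathcal C$, such that $\mathcal J(\mathcal T)=\bigcup_{(X_C=\mathbf x_C)\in\mathcal C}\mathrm{global}(G_{X_C=\mathbf x_C})$ (for example, the collection of minimal contexts of $\mathcal T$ with their minimal context DAGs). Then $\mathcal T$ is balanced if and only if $$\ker(\psi_{\mathcal T})=\sum_{(X_C=\mathbf x_C)\in\mathcal C}I_{\mathrm{Sat}((G_{X_C=\mathbf x_C})^{\mathrm{per}})}.$$ In particular, every decomposable CSmodel can be described by a collection of perfect DAGs: if $\mathcal T$ is balanced, there is a collection of contexts $X_C=\mathbf x_C$ with perfect DAGs $H_{X_C=\mathbf x_C}$ on $[p]\setminus C$ such that $\ker(\psi_{\mathcal T})=\sum I_{\mathrm{Sat}(H_{X_C=\mathbf x_C})}$.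
   Context: Notation. $[p]=\{1,\dots,p\}$; $X_1,\dots,X_p$ are discrete random variables, $X_i$ with state space $[d_i]=\{1,\dots,d_i\}$. For $A\subseteq[p]$ let $\mathcal R_A=\prod_{i\in A}[d_i]$, $\mathcal R=\mathcal R_{[p]}$. For $\mathbf x\in\mathcal R_B$ and $A\subseteq B$, $\mathbf x_A=(x_i)_{i\in A}$; for disjoint $A,B$, $\mathbf x_A\mathbf x_B\in\mathcal R_{A\cup B}$ is the combined outcome. $\mathbb R[D]=\mathbb R[p_{\mathbf x}:\mathbf x\in\mathcal R]$. CStrees. Let $\mathcal T=(V,E)$ be the rooted tree with $V=\{\mathrm{root}\}\cup\bigcup_{j\in[p]}\mathcal R_{[j]}$ and edges $\mathrm{root}\to x_1$ and $x_1\cdots x_{k-1}\to x_1\cdots x_k$. Its $k$-th level is $L_k=\mathcal R_{[k]}$ ($L_0=\{\mathrm{root}\}$); $E(v)$ is the set of outgoing edges of $v$. A labeling $\theta:E\to\mathcal L$ ($\mathcal L$ a finite set) makes $\mathcal T$ a staged tree if $|\theta(E(v))|=|E(v)|$ for all $v$, and $\theta(E(v)),\theta(E(w))$ are equal or disjoint for all $v,w$. Non-leaf vertices $v,w$ are in the same stage iff $\theta(E(v))=\theta(E(w))$; the equivalence classes are the stages (leaves are regarded as singleton stages). A staged tree is a CStree if: (1) $\theta(E(v))\ne\theta(E(w))$ for non-leaf $v,w$ in different levels; (2) $\theta(x_1\cdots x_{k-1}\to x_1\cdots x_{k-1}x_k)=\theta(y_1\cdots y_{k-1}\to y_1\cdots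 y_{k-1}x_k)$ whenever $x_1\cdots x_{k-1}$ and $y_1\cdots y_{k-1}$ are in the same stage; (3) for every $k\in[p]$ and every stage $S\subseteq L_{k-1}$ there are $C\subseteq[k-1]$ and $\mathbf x_C\in\mathcal R_C$ with $S=\{\mathbf x_C\mathbf y:\mathbf y\in\mathcal R_{[k-1]\setminus C}\}$. Balanced. For $v\in L_{k-1}$ let $t(v)=\sum_{\mathbf z\in\mathcal R_{[p]\setminus[k-1]}}\prod_{e\in E(v\to v\mathbf z)}\theta(e)$ in the polynomial ring $\mathbb R[\theta(e):e\in E]$ whose variables are the labels ($E(v\to v\mathbf z)$: edges on the path from $v$ to $v\mathbf z$). $\mathcal T$ is balanced if for every $k\in[p]$, all $v,w\in L_{k-1}$ in the same stage and all $s,r\in[d_k]$: $t(vs)t(wr)=t(vr)t(ws)$ in this ring. A decomposable CSmodel is the model $\mathcal M(\mathcal T)$ of a balanced CStree. The map $\psi_{\mathcal T}$. Let $\langle\theta-1\rangle=\langle\sum_{e\in E(v)}\theta(e)-1: v\in V\text{ non-leaf}\rangle$ and $\mathbb R[\Theta_{\mathcal T}]=\mathbb R[\theta(e):e\in E]/\langle\theta-1\rangle$. With a homogenizing variable $z$, $\psi_{\mathcal T}:\mathbb R[D]\to\mathbb R[\Theta_{\mathcal T}][z]$ is the ring homomorphism $p_{\mathbf x}\mapsto z\prod_{e\in E(\mathrm{root}\to\mathbf x)}\theta(e)$, where $E(\mathrm{root}\to\mathbf x)$ is the set of edges of the path from the root to the leaf $\mathbf x$. CSI statements and $\mathcal J(\mathcal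 T)$. A CSI statement is written $X_A\perp X_B\mid X_S,X_C=\mathbf x_C$ with $A,B,S,C\subseteq[p]$ pairwise disjoint and $\mathbf x_C\in\mathcal R_C$ (trivial if $A$ or $B$ is empty); if $C=\emptyset$ it is a CI statement. It is saturated if $A\cup B\cup S\cup C=[p]$. The polynomials associated to a saturated statement are $p_{\mathbf x_A\mathbf x_B\mathbf x_S\mathbf x_C}p_{\mathbf y_A\mathbf y_B\mathbf x_S\mathbf x_C}-p_{\mathbf x_A\mathbf y_B\mathbf x_S\mathbf x_C}p_{\mathbf y_A\mathbf x_B\mathbf x_S\mathbf x_C}$ for all $\mathbf x_A,\mathbf y_A\in\mathcal R_A$, $\mathbf x_B,\mathbf y_B\in\mathcal R_B$, $\mathbf x_S\in\mathcal R_S$. For a stage $S\subseteq L_{k-1}$ let $C\subseteq[k-1]$ be the set of indices at which all elements of $S$ agree and $\mathbf x_C$ the common value; the stage statement is $X_k\perp X_{[k-1]\setminus C}\mid X_C=\mathbf x_C$. $\mathcal J(\mathcal T)$ is the set of all CSI statements derivable from the stage statements by the CSI axioms (all index sets disjoint; $A\perp B|S,\mathbf x_C$ abbreviates $X_A\perp X_B|X_S,X_C=\mathbf x_C$): symmetry: $A\perp B|S,\mathbf x_C\Rightarrow B\perp A|S,\mathbf x_C$; decomposition: $A\perp B\cup D|S,\mathbf x_C\Rightarrow A\perp B|S,\mathbf x_C$; weak union: $A\perp B\cup D|S,\mathbf x_C\Rightarrow A\perp B|S\cup D,\mathbf x_C$; contraction: $A\perp B|S\cup D,\mathbf x_C$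 and $A\perp D|S,\mathbf x_C\Rightarrow A\perp B\cup D|S,\mathbf x_C$; intersection: $A\perp B|S\cup D,\mathbf x_C$ and $A\perp S|B\cup D,\mathbf x_C\Rightarrow A\perp B\cup S|D,\mathbf x_C$; specialization: $A\perp B|S,\mathbf x_C$, $T\subseteq S$, $\mathbf x_T\in\mathcal R_T\Rightarrow A\perp B|S\setminus T,\mathbf x_{T\cup C}$; absorption: if for some $T\subseteq C$ one has $A\perp B|S,\mathbf x_{C\setminus T}\mathbf x_T$ for all $\mathbf x_T\in\mathcal R_T$, then $A\perp B|S\cup T,\mathbf x_{C\setminus T}$. Context DAGs. A DAG $G_{X_C=\mathbf x_C}$ associated to a context $X_C=\mathbf x_C$ has vertex set $[p]\setminus C$ and all edges $i\to j$ with $i<j$. $\mathrm{global}(G_{X_C=\mathbf x_C})$ is the set of its d-separation statements $X_A\perp X_B|X_S$ ($A,B,S\subseteq[p]\setminus C$), each read as the CSI statement $X_A\perp X_B|X_S,X_C=\mathbf x_C$. The condition $\mathcal J(\mathcal T)=\bigcup_{\mathcal C}\mathrm{global}(G_{X_C=\mathbf x_C})$ means that the CSI statements that hold in $\mathcal T$ are the same as those that hold in the context DAGs, statements being identified up to specialization and absorption (i.e. $\mathcal J(\mathcal T)$ is the closure of the right-hand side under these two axioms). For a DAG $H$ associated to the context $X_C=\mathbf x_C$, $\mathrm{Sat}(H)$ is the set of those statements of $\mathrm{global}(H)$ with $A\cup B\cup S=[p]\setminus C$, and $I_{\mathrm{Sat}(H)}\subseteq\mathbb R[D]$ is the ideal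 generated by the polynomials associated to the saturated CSI statements $X_A\perp X_B|X_S,X_C=\mathbf x_C$ with $X_A\perp X_B|X_S\in\mathrm{Sat}(H)$. Minimal contexts. $X_C=\mathbf x_C$ ($C$ possibly empty) is a minimal context of $\mathcal T$ if there is a statement $X_A\perp X_B|X_S,X_C=\mathbf x_C$ in $\mathcal J(\mathcal T)$ with $A,B\neq\emptyset$ such that for no nonempty $T\subseteq C$ is $X_A\perp X_B|X_{S\cup T},X_{C\setminus T}=\mathbf x_{C\setminus T}$ in $\mathcal J(\mathcal T)$. Its minimal context DAG $G_{X_C=\mathbf x_C}$ is the DAG on $[p]\setminus C$, edges $i\to j$ only with $i<j$, that is a minimal I-MAP of $\mathcal J(X_C=\mathbf x_C)=\{X_A\perp X_B|X_S:\ X_A\perp X_B|X_S,X_C=\mathbf x_C\in\mathcal J(\mathcal T)\}$: all its d-separation statements lie in this set, and this fails after removing any edge. Directed moralization. For a DAG $G$ with all edges $i\to j$ satisfying $i<j$, $G^{dm}$ is the DAG on the same vertices with all edges of $G$ and an edge $u\to v$ whenever $u<v$ and $u\to w$, $v\to w$ are edges of $G$ for some $w$. $G^{\mathrm{per}}$ is obtained from $G$ by applying this operation $\binom p2$ times; it is a perfect DAG, where a DAG is perfect if any two parents of a common vertex are adjacent.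
   Formalization: Every variable is assumed to have at least two states (the claim fails with one-state variables), and the parenthetical that minimal contexts always satisfy the displayed condition is not asserted (it fails for some CStrees); they are covered whenever the condition holds. *)

(* Defs.v *)
From HB Require Import structures.
From mathcomp Require Import all_boot all_order all_algebra.
From mathcomp Require Import ring_quotient mpoly.
From mathcomp Require Import boolp reals.

Set Implicit Arguments.
Unset Strict Implicit.
Unset Printing Implicit Defensive.

Import GRing.Theory Num.Theory.
Local Open Scope ring_scope.

(* Indices are shifted: X_k (1 <= k <= p) is indexed by k - 1 : 'I_p, so that
   it branches off from level k - 1 of the tree, and its states are 0, ...,
   d - 1.  A random variable has at least two states; otherwise the set C and
   the outcome x_C are not determined by the stage {x_C y : y}. *)
Record sizes (p : nat) := Sizes {
  nstates :> 'I_p -> nat;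
  nstates_gt1 : forall i, (1 < nstates i)%N }.

Section Outcomes.
Variables (p : nat) (d : sizes p).

Definition outcome := {dffun forall i : 'I_p, 'I_(d i)}.

(* A partial outcome x encodes the pair of C = dom x and x_C in R_C. *)
Definition poutcome := {dffun forall i : 'I_p, option 'I_(d i)}.

Definition dom (x : poutcome) : {set 'I_p} := [set i | x i != None].

Definition full_outcome (x : outcome) : poutcome := [ffun i => Some (x i)].

Definition extends (x y : poutcome) : bool :=
  [forall i, (i \in dom x) ==> (y i == x i)].

(* x_A x_B, for disjoint A = dom x and B = dom y *)
Definition join (x y : poutcome) : poutcome :=
  [ffun i => if i \in dom x then x i else y i].

Definition mix (B : {set 'I_p}) (x y : outcome) : outcome :=
  [ffun i => if i \in B then y i else x i].

Definition below (k : nat) : {set 'I_p} := [set i : 'I_p | (i < k)%N].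

(* The vertices of the tree are the partial outcomes in the levels 0, ..., p. *)
Definition level (k : nat) : {set poutcome} := [set v | dom v == below k].

Definition tree_root : poutcome := [ffun => None].

Definition nonleaf : {set poutcome} := \bigcup_(k < p) level k.

Definition is_edge (vw : poutcome * poutcome) : bool :=
  [exists k : 'I_p,
    [&& vw.1 \in level k, vw.2 \in level k.+1 & extends vw.1 vw.2]].

Definition edge := {vw : poutcome * poutcome | is_edge vw}.
HB.instance Definition _ := Finite.on edge.

Definition src (e : edge) : poutcome := (val e).1.
Definition tgt (e : edge) : poutcome := (val e).2.

Definition out_edges (v : poutcome) : {set edge} := [set e | src e == v].

Definition path_edges (v w : poutcome) : {set edge} :=
  [set e | extends v (src e) && extends (tgt e) w].

(* the child v s of a vertex v in level k *)
Definition child (v : poutcome) (k : 'I_p) (s : 'I_(d k)) : poutcome :=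
  [ffun i => dfwith v (Some s) i].

Lemma child_level (v : poutcome) (k : 'I_p) (s : 'I_(d k)) :
  v \in level k -> child v s \in level k.+1.
Proof.
rewrite !inE => /eqP/setP domv; apply/eqP/setP => i.
have {domv} := domv i; rewrite !inE ffunE => domv_i.
have [eq_ik|ne_ik] := eqVneq i k; first by rewrite eq_ik dfwith_in ltnSn.
have ne_ki : k != i by rewrite eq_sym.
rewrite dfwith_out // domv_i ltnS [RHS]leq_eqVlt.
by rewrite val_eqE (negbTE ne_ik).
Qed.

Lemma child_extends (v : poutcome) (k : 'I_p) (s : 'I_(d k)) :
  v \in level k -> extends v (child v s).
Proof.
rewrite inE => /eqP/setP domv; apply/forallP => i; apply/implyP => iv.
rewrite ffunE dfwith_out //; apply/eqP => eq_ki.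
by have := domv i; rewrite iv inE eq_ki ltnn.
Qed.

Lemma out_edges_neq0 (v : poutcome) :
  v \in nonleaf -> (0 < #|out_edges v|)%N.
Proof.
case/bigcupP => k _ vk.
pose s := Ordinal (ltnW (nstates_gt1 d k)).
have Ee : is_edge (v, child v s).
  by apply/existsP; exists k; rewrite vk child_level ?child_extends.
by apply/card_gt0P; exists (exist (fun vw => is_edge vw) _ Ee); rewrite inE.
Qed.

End Outcomes.

Section Staging.
Variables (p : nat) (d : sizes p) (L : finType) (theta : edge d -> L).

Definition floret (v : poutcome d) : {set L} := theta @: out_edges v.

Definition staged : Prop :=
  (forall v, v \in nonleaf d -> #|floret v| = #|out_edges v|) /\
  (forall v w, v \in nonleaf d -> w \in nonleaf d ->
     floret v = floret w \/ [disjoint floret v & floret w]).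

Definition same_stage (v w : poutcome d) : bool :=
  [&& v \in nonleaf d, w \in nonleaf d & floret v == floret w].

(* The singleton stages of the leaves are left out. *)
Definition stages : {set {set poutcome d}} :=
  [set [set w | same_stage v w] | v in nonleaf d].

End Staging.

Record cstree (p : nat) (d : sizes p) (L : finType) := CSTree {
  theta :> edge d -> L;
  cstree_staged : staged theta;
  cstree_levels : forall (j k : 'I_p) (v w : poutcome d),
    v \in level d j -> w \in level d k -> j != k ->
    floret theta v <> floret theta w;
  cstree_labels : forall (k : 'I_p) (e f : edge d),
    src e \in level d k -> src f \in level d k ->
    same_stage theta (src e) (src f) -> tgt e k = tgt f k ->
    theta e = theta f;
  cstree_stages : forall (k : 'I_p) (S : {set poutcome d}),
    S \in stages theta -> S \subset level d k ->
    exists2 c : poutcome d,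
      dom c \subset below p k & S = [set w in level d k | extends c w] }.

(* The combination is finite; for an infinite P, n depends on f. *)
Definition ideal_gen (A : comNzRingType) (P : A -> Prop) (f : A) : Prop :=
  exists n (a g : 'I_n -> A),
    (forall i, P (g i)) /\ f = \sum_(i < n) a i * g i.

Lemma ideal_gen0 (A : comNzRingType) (P : A -> Prop) : ideal_gen P 0.
Proof.
exists 0, (fun=> 0), (fun=> 0); split; first by case.
by rewrite big_ord0.
Qed.

Lemma ideal_genMD (A : comNzRingType) (P : A -> Prop) (b f h : A) :
  ideal_gen P f -> ideal_gen P h -> ideal_gen P (b * f + h).
Proof.
move=> [n [a [g [Pg ->]]]] [m [a' [g' [Pg' ->]]]].
exists (n + m)%N.
exists (fun i => match split i with inl j => b * a j | inr j => a' j end).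
exists (fun i => match split i with inl j => g j | inr j => g' j end).
split=> [i|]; first by case: (split i).
rewrite big_split_ord /= mulr_sumr; congr (_ + _); apply: eq_bigr => i _.
  case: (splitP (lshift m i)) => [j /= /val_inj <-|k /= Ek].
    by rewrite mulrA.
  by have := ltn_ord i; rewrite Ek ltnNge leq_addr.
case: (splitP (rshift n i)) => [j /= Ej|k /= /addnI/val_inj <- //].
by have := ltn_ord j; rewrite -Ej ltnNge leq_addr.
Qed.

Section Rings.
Variables (R : realType) (p : nat) (d : sizes p) (L : finType).
Variable T : cstree d L.

(* the labels that occur: the variables of the ring R[theta(e) : e in E] *)
Definition label := {l : L | l \in codom T}.
HB.instance Definition _ := Finite.on label.

Definition label_of (e : edge d) : label :=
  exist (fun l => l \in codom T) (T e) (codom_f T e).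

Definition label_ring := {mpoly R[#|{: label}|]}.
HB.instance Definition _ := GRing.ComNzRing.on label_ring.

Definition tvar (e : edge d) : label_ring := 'X_(enum_rank (label_of e)).

Definition tpoly (v : poutcome d) : label_ring :=
  \sum_(x : outcome d | extends v (full_outcome x))
    \prod_(e in path_edges v (full_outcome x)) tvar e.

Definition balanced : Prop :=
  forall (k : 'I_p) (v w : poutcome d),
    v \in level d k -> w \in level d k -> same_stage T v w ->
    forall s r : 'I_(d k),
      tpoly (child v s) * tpoly (child w r)
      = tpoly (child v r) * tpoly (child w s).

Definition sum_to_one (g : label_ring) : Prop :=
  exists2 v, v \in nonleaf d & g = \sum_(e in out_edges v) tvar e - 1.

Definition theta_ideal : pred label_ring :=
  fun f => `[< ideal_gen sum_to_one f >].

(* Evaluating every label at the inverse size of its floret kills the ideal. *)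
Lemma theta_ideal_proper : 1 \notin theta_ideal.
Proof.
have [card_fl disj_fl] := cstree_staged T.
have iinvP l : T (iinv (valP (l : label))) = val l by rewrite f_iinv.
have src_nl e : src e \in nonleaf d.
  have /existsP[k /and3P[ek _ _]] := valP e.
  by apply/bigcupP; exists k.
pose h (i : 'I_#|{: label}|) : R :=
  #|floret T (src (iinv (valP (enum_val i))))|%:R^-1.
have hE v e : v \in nonleaf d -> e \in out_edges v ->
    h (enum_rank (label_of e)) = #|out_edges v|%:R^-1.
  move=> v_nl ev; rewrite /h enum_rankK -card_fl //.
  congr (_%:R^-1); set e' := iinv _.
  have le' : T e' = T e by rewrite /e' iinvP.
  case: (disj_fl (src e') v) => [//|//|-> //|].
  move/pred0P => /(_ (T e)) /=.
  by rewrite -{1}le' !imset_f // inE.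
apply/negP => /asboolP[n [a [g [Pg E1]]]].
have /(congr1 (meval h)) := E1.
rewrite meval1 raddf_sum /= big1 => [/eqP|i _]; first by rewrite oner_eq0.
rewrite mevalM; have [v v_nl ->] := Pg i.
rewrite mevalB meval1 raddf_sum /= (eq_bigr (fun=> #|out_edges v|%:R^-1)).
  rewrite sumr_const -[X in X - 1]mulr_natl mulfV ?subrr ?mulr0 //.
  by rewrite pnatr_eq0 -lt0n out_edges_neq0.
by move=> e ev; rewrite mevalXU (hE v).
Qed.

Lemma theta_ideal_idealr : idealr_closed theta_ideal.
Proof.
split; [exact/asboolP/ideal_gen0 | exact: theta_ideal_proper |].
move=> a u v /asboolP Iu /asboolP Iv.
exact/asboolP/ideal_genMD.
Qed.
HB.instance Definition _ :=
  isIdealr.Build label_ring theta_ideal theta_ideal_idealr.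

Definition theta_idealr : idealr label_ring := theta_ideal.
Definition theta_quot := {ideal_quot theta_idealr}.
HB.instance Definition _ := GRing.ComNzRing.on theta_quot.

Definition theta_pi : {rmorphism label_ring -> theta_quot} :=
  \pi_theta_quot%qT.

Definition outcome_ring := {mpoly R[#|{: outcome d}|]}.

Definition pvar (x : outcome d) : outcome_ring := 'X_(enum_rank x).

(* 'X : {poly theta_quot} is the homogenizing variable z. *)
Definition psi : {rmorphism outcome_ring -> {poly theta_quot}} :=
  mmap (polyC \o theta_pi \o @mpolyC _ R)
    (fun i => 'X * (theta_pi
       (\prod_(e in path_edges (tree_root d) (full_outcome (enum_val i)))
          tvar e))%:P).

End Rings.

Section CSI.
Variables (p : nat) (d : sizes p).
Implicit Types (A B D S : {set 'I_p}) (c : poutcome d).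

(* Csi A B S c is the statement X_A _||_ X_B | X_S, X_(dom c) = c. *)
Record csi := Csi {
  lhs : {set 'I_p};
  rhs : {set 'I_p};
  cond : {set 'I_p};
  ctx : poutcome d }.

Definition wf_csi (st : csi) : bool :=
  [&& [disjoint lhs st & rhs st], [disjoint lhs st & cond st],
      [disjoint rhs st & cond st]
    & [disjoint lhs st :|: rhs st :|: cond st & dom (ctx st)]].

Definition trivial_csi (st : csi) : bool :=
  (lhs st == set0) || (rhs st == set0).

(* The side conditions keep the four index sets of a statement disjoint. *)
Inductive derivable (P : csi -> Prop) : csi -> Prop :=
| der_axiom st : P st -> derivable P st
| der_symmetry A B S c :
    derivable P (Csi A B S c) -> derivable P (Csi B A S c)
| der_decomposition A B D S c : [disjoint B & D] ->
    derivable P (Csi A (B :|: D) S c) -> derivable P (Csi A B S c)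
| der_weak_union A B D S c : [disjoint B & D] ->
    derivable P (Csi A (B :|: D) S c) -> derivable P (Csi A B (S :|: D) c)
| der_contraction A B D S c : [disjoint S & D] ->
    derivable P (Csi A B (S :|: D) c) -> derivable P (Csi A D S c) ->
    derivable P (Csi A (B :|: D) S c)
| der_intersection A B D S c : [disjoint S & D] -> [disjoint B & D] ->
    derivable P (Csi A B (S :|: D) c) -> derivable P (Csi A S (B :|: D) c) ->
    derivable P (Csi A (B :|: S) D c)
| der_specialization A B S c (x : poutcome d) : dom x \subset S ->
    derivable P (Csi A B S c) ->
    derivable P (Csi A B (S :\: dom x) (join x c))
| der_absorption A B S c (U : {set 'I_p}) : [disjoint U & dom c] ->
    (forall x : poutcome d, dom x = U -> derivable P (Csi A B S (join x c))) ->
    derivable P (Csi A B (S :|: U) c).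

Inductive spec_abs_closure (P : csi -> Prop) : csi -> Prop :=
| sac_axiom st : P st -> spec_abs_closure P st
| sac_specialization A B S c (x : poutcome d) : dom x \subset S ->
    spec_abs_closure P (Csi A B S c) ->
    spec_abs_closure P (Csi A B (S :\: dom x) (join x c))
| sac_absorption A B S c (U : {set 'I_p}) : [disjoint U & dom c] ->
    (forall x : poutcome d, dom x = U ->
       spec_abs_closure P (Csi A B S (join x c))) ->
    spec_abs_closure P (Csi A B (S :|: U) c).

(* c is the restriction of the elements of S to the indices where they agree *)
Definition common_context (S : {set poutcome d}) (c : poutcome d) : Prop :=
  forall (i : 'I_p) (a : 'I_(d i)),
    c i = Some a <-> (forall w, w \in S -> w i = Some a).

Definition stage_csi (L : finType) (T : cstree d L) (st : csi) : Prop :=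
  exists (k : 'I_p) (S : {set poutcome d}) (c : poutcome d),
    [/\ S \in stages T, S \subset level d k, common_context S c
      & st = Csi [set k] (below p k :\: dom c) set0 c].

Definition J (L : finType) (T : cstree d L) : csi -> Prop :=
  derivable (stage_csi T).

End CSI.

Section DAGs.
Variable p : nat.
Implicit Types (G : rel 'I_p) (A B S : {set 'I_p}).

Definition adjacent G : rel 'I_p := fun u v => G u v || G v u.

(* m does not block a path through the consecutive vertices u, m, w *)
Definition open_at G S (u m w : 'I_p) : bool :=
  if G u m && G w m then [exists z in S, connect G m z] else m \notin S.

Fixpoint active G S (s : seq 'I_p) : bool :=
  if s is u :: s1
  then (if s1 is m :: w :: _ then open_at G S u m w else true) && active G S s1
  else true.

Definition dsep G A B S : Prop :=
  forall a s, path (adjacent G) a s -> uniq (a :: s) ->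
    a \in A -> last a s \in B -> ~~ active G S (a :: s).

Definition perfect G : Prop :=
  forall u v w, G u w -> G v w -> u != v -> adjacent G u v.

Definition dm G : rel 'I_p :=
  fun u v => G u v || (u < v)%N && [exists w, G u w && G v w].

Definition per G : rel 'I_p := iter 'C(p, 2) dm G.

Definition context_dag (d : sizes p) (c : poutcome d) G : Prop :=
  forall u v, G u v -> [/\ u \notin dom c, v \notin dom c & (u < v)%N].

Definition global (d : sizes p) (c : poutcome d) G (st : csi d) : Prop :=
  [/\ ctx st = c, wf_csi st & dsep G (lhs st) (rhs st) (cond st)].

Definition saturated (d : sizes p) (st : csi d) : bool :=
  lhs st :|: rhs st :|: cond st :|: dom (ctx st) == setT.

Definition Sat (d : sizes p) (c : poutcome d) G (st : csi d) : Prop :=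
  global c G st /\ saturated st.

End DAGs.

(* Trivial statements (A or B empty) hold everywhere and are disregarded. *)
Definition J_is_union_of_globals (p : nat) (d : sizes p) (L : finType)
    (T : cstree d L) (Cs : {set poutcome d}) (G : poutcome d -> rel 'I_p) :
    Prop :=
  forall st : csi d, ~~ trivial_csi st ->
    (J T st <->
     spec_abs_closure (fun st' => exists2 c, c \in Cs & global c (G c) st') st).

Section Ideals.
Variables (R : realType) (p : nat) (d : sizes p).
Local Notation RD := (outcome_ring R d).
Local Notation pv := (@pvar R p d).

(* With A = lhs st, B = rhs st, x = x_A x_B x_S x_C and y = y_A y_B x_S x_C,
   mix B x y = x_A y_B x_S x_C and mix A x y = y_A x_B x_S x_C. *)
Definition csi_poly (st : csi d) (f : RD) : Prop :=
  exists x y : outcome d,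
    [/\ extends (ctx st) (full_outcome x), extends (ctx st) (full_outcome y),
        {in cond st, forall i, x i = y i}
      & f = pv x * pv y - pv (mix (rhs st) x y) * pv (mix (lhs st) x y)].

Definition I_Sat (c : poutcome d) (G : rel 'I_p) : RD -> Prop :=
  ideal_gen (fun f => exists2 st : csi d, Sat c G st & csi_poly st f).

Definition ideal_sum (Cs : {set poutcome d}) (I : poutcome d -> RD -> Prop)
    (f : RD) : Prop :=
  exists2 g : poutcome d -> RD,
    (forall c, c \in Cs -> I c (g c)) & f = \sum_(c in Cs) g c.

Definition ker_psi (L : finType) (T : cstree d L) (f : RD) : Prop :=
  psi R T f = 0.

End Ideals.

(* Main.v *)
(* A polynomial lies in ker psi iff it vanishes at z q_h for all z > 0 and all
   positive label values h whose florets sum to one, where q_h(x) is the product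
   of the labels on the path to x: solve each floret relation for one label.

   Evaluated there, the CSI axioms are sound (q_h is positive, so intersection
   holds), hence the binomials of the saturated statements of J(T) lie in ker psi.

   If T is balanced, then for every positive a without the sum condition q_a is a
   multiple of some q_h, so ker psi is contained in the toric ideal of the map
   p_x |-> z * (product of labels), which is spanned by binomials. Two monomials
   with the same image are connected by making the first outcome of one agree with
   an outcome of the other level by level, swapping tails between outcomes v s, w r
   whose prefixes v, w lie in one stage. Balancedness, propagated upwards through
   the levels, yields for each stage context x_C at level k a set D of indices
   >= k, containing k, such that within the context the stage at a level m depends
   only on the coordinates in D if m is in D, and only on the others if not. This
   gives D _||_ rest | x_C in J(T). It must come from a d-separation statement of a
   context DAG of a subcontext; as D lies after C, directed moralization adds no
   edge between D and the rest, so the statement survives in the perfect DAG.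

   Conversely, a pure quadratic binomial vanishing at all q_h vanishes at all q_a
   (compare exponents label by label). If such binomials generate ker psi, then
   (sum vs)(sum wr) - (sum vr)(sum ws), which lies in ker psi, vanishes at all q_a,
   and this is the balancedness identity.

   For the last assertion take, in each context, the equivalence classes of indices
   not separated by any set whose swap preserves products of path monomials; a
   disjoint union of complete DAGs is perfect. *)
Require Import Defs.
From mathcomp Require Import all_boot all_order all_algebra mpoly reals.
From mathcomp Require Import boolp ring_quotient ring.

Set Implicit Arguments.
Unset Strict Implicit.
Unset Printing Implicit Defensive.

Import Order.TTheory GRing.Theory Num.Theory.
Local Open Scope ring_scope.

(** * Outcomes and partial outcomes *)

Section Agreement.
Variables (p : nat) (d : sizes p).
Implicit Types (V E D A B : {set 'I_p}) (x y z : outcome d) (c v w : poutcome d).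

Definition agree V x y := [forall i in V, x i == y i].

Lemma agreeP V x y : reflect {in V, forall i, x i = y i} (agree V x y).
Proof. exact: 'forall_in_eqP. Qed.

Lemma agree_refl V x : agree V x x.
Proof. exact/agreeP. Qed.

Lemma agree_sym V x y : agree V x y = agree V y x.
Proof. by apply/agreeP/agreeP => H i /H. Qed.

Lemma agree_trans V x y z : agree V x y -> agree V y z -> agree V x z.
Proof. by move=> /agreeP xy /agreeP yz; apply/agreeP=> i Vi; rewrite xy ?yz. Qed.

Lemma agree_sub V E x y : V \subset E -> agree E x y -> agree V x y.
Proof. by move=> /subsetP sVE /agreeP H; apply/agreeP=> i /sVE /H. Qed.

Lemma agreeU V E x y : agree (V :|: E) x y = agree V x y && agree E x y.
Proof.
apply/agreeP/andP => [H|[/agreeP HV /agreeP HE] i].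
  by split; apply/agreeP=> i Hi; apply: H; rewrite inE Hi ?orbT.
by rewrite inE => /orP[/HV|/HE].
Qed.

Lemma agree_setT x y : agree setT x y = (x == y).
Proof.
by apply/agreeP/eqP => [H|-> //]; apply/ffunP=> i; apply: H.
Qed.

Lemma mixE D x y i : mix D x y i = if i \in D then y i else x i.
Proof. by rewrite ffunE. Qed.

Lemma agree_mixr D V x y : V \subset D -> agree V (mix D x y) y.
Proof. by move=> /subsetP sV; apply/agreeP=> i /sV Di; rewrite mixE Di. Qed.

Lemma agree_mixl D V x y : [disjoint V & D] -> agree V (mix D x y) x.
Proof.
by move=> dVD; apply/agreeP=> i Vi; rewrite mixE (disjointFr dVD Vi).
Qed.

Lemma agree_mix D V x y z : agree V z x -> agree V z y -> agree V z (mix D x y).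
Proof.
move=> /agreeP zx /agreeP zy; apply/agreeP=> i Vi; rewrite mixE.
by case: ifP => _; [apply: zy | apply: zx].
Qed.

Lemma extendsP c x :
  reflect (forall i, i \in dom c -> c i = Some (x i)) (extends c (full_outcome x)).
Proof.
apply: (iffP forallP) => [H i ic|H i].
  by have /implyP/(_ ic) := H i; rewrite ffunE => /eqP.
by apply/implyP=> /H ->; rewrite ffunE.
Qed.

Lemma extends_agree c x y : extends c (full_outcome x) ->
  extends c (full_outcome y) = agree (dom c) x y.
Proof.
move=> /extendsP cx; apply/extendsP/agreeP=> [cy i ic|xy i ic].
  by have := cy i ic; rewrite cx // => -[].
by rewrite cx // xy.
Qed.

Lemma extends_mix c D x y : extends c (full_outcome x) ->
  extends c (full_outcome y) -> extends c (full_outcome (mix D x y)).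
Proof.
move=> cx cy; rewrite (extends_agree _ cx) agree_mix ?agree_refl //.
by rewrite -(extends_agree _ cx).
Qed.

Definition restrict V x : poutcome d := [ffun i => if i \in V then Some (x i) else None].

Lemma dom_restrict V x : dom (restrict V x) = V.
Proof. by apply/setP=> i; rewrite inE ffunE; case: ifP. Qed.

Lemma extends_restrict V x y :
  extends (restrict V x) (full_outcome y) = agree V x y.
Proof.
apply/extendsP/agreeP; rewrite dom_restrict => H i Vi.
  by have := H i Vi; rewrite ffunE Vi => -[].
by rewrite ffunE Vi H.
Qed.

Lemma restrict_extends c x : extends c (full_outcome x) -> c = restrict (dom c) x.
Proof.
move=> /extendsP cx; apply/ffunP=> i; rewrite ffunE; case: ifP => [/cx //|].
by rewrite inE => /negbFE/eqP.
Qed.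

Definition state0 (i : 'I_p) : 'I_(d i) := Ordinal (ltnW (nstates_gt1 d i)).

Definition fill c : outcome d := [ffun i => odflt (state0 i) (c i)].

Lemma extends_fill c : extends c (full_outcome (fill c)).
Proof.
by apply/extendsP=> i; rewrite inE ffunE; case: (c i).
Qed.

Lemma restrict_inj V x y : (restrict V x = restrict V y) <-> agree V x y.
Proof.
split=> [E|/agreeP xy]; last first.
  by apply/ffunP=> i; rewrite !ffunE; case: ifP => // /xy ->.
by rewrite -extends_restrict E extends_restrict agree_refl.
Qed.

Lemma sum_agree (W : nmodType) V E x (F : outcome d -> W) : [disjoint V & E] ->
  \sum_(y | agree V x y) F y
  = \sum_(z | agree (~: E) x z) \sum_(y | agree (V :|: E) z y) F y.
Proof.
move=> dVE; rewrite (exchange_big_dep (agree V x)) /=.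
  apply: eq_bigr => y xy; rewrite (big_pred1 (mix E x y)) // => z /=.
  apply/andP/eqP => [[/agreeP xz /agreeP zy]|->].
    apply/ffunP=> i; rewrite mixE; case: ifP => [iE|niE].
      by rewrite zy // inE iE orbT.
    by rewrite xz // inE niE.
  rewrite agreeU (@agree_mixr E E) // andbT; split.
    by rewrite agree_sym agree_mixl // disjoints_subset.
  by apply: agree_trans xy; rewrite agree_mixl.
move=> y z xy /agreeP zy; apply/agreeP=> i Vi.
rewrite -zy ?inE ?Vi //; apply: (agreeP _ _ _ xy).
by rewrite inE (disjointFr dVE Vi).
Qed.

End Agreement.

Lemma poly_eq0_itv (R : realType) (P : {poly R}) (e : R) : 0 < e ->
  (forall t, 0 < t < e -> P.[t] = 0) -> P = 0.
Proof.
move=> e0 H; pose s := [seq e / (i.+2)%:R | i <- iota 0 (size P)].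
apply: (roots_geq_poly_eq0 (rs := s)); last by rewrite size_map size_iota.
  apply/allP=> _ /mapP[i _ ->]; apply/rootP/H.
  rewrite divr_gt0 ?ltr0n //= ltr_pdivrMr ?ltr0n // ltr_pMr // ltr1n //.
rewrite map_inj_in_uniq ?iota_uniq // => i j _ _ /(mulfI (lt0r_neq0 e0)) /invr_inj.
by move=> /eqP; rewrite eqr_nat => /eqP[].
Qed.

Lemma sum_monomials_eq0 (R : realType) (I : Type) (J : finType) (r : seq I)
    (c : I -> R) (e : I -> J -> nat) (eps : R) : 0 < eps ->
  (forall h : J -> R, (forall j, 0 < h j < eps) ->
     \sum_(i <- r) c i * \prod_j h j ^+ e i j = 0) ->
  forall e0 : J -> nat, \sum_(i <- r | [forall j, e i j == e0 j]) c i = 0.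
Proof.
move=> eps0 H e0.
have K (s : seq J) : uniq s -> forall h : J -> R, (forall j, 0 < h j < eps) ->
    \sum_(i <- r | all (fun j => e i j == e0 j) s)
      c i * \prod_(j | j \notin s) h j ^+ e i j = 0.
  elim: s => [_ h h0|j0 s IHs /= /andP[js us] h h0].
    by rewrite -[RHS](H h h0); apply: eq_big.
  pose P : {poly R} := \sum_(i <- r | all (fun j => e i j == e0 j) s)
     (c i * \prod_(j | (j \notin s) && (j != j0)) h j ^+ e i j) *: 'X^(e i j0).
  have PE : P = 0.
    apply: (poly_eq0_itv eps0) => t tP; pose h' := [fun j => h j with j0 |-> t].
    rewrite -[RHS](IHs us h') => [|j]; last by rewrite /=; case: ifP.
    rewrite horner_sum; apply: eq_bigr => i _.
    rewrite hornerZ hornerXn -mulrA; congr (_ * _).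
    rewrite [RHS](bigD1 j0) //= eqxx mulrC; congr (_ * _).
    by apply: eq_bigr => j /andP[_ /negbTE ->].
  have := congr1 (fun Q : {poly R} => Q`_(e0 j0)) PE.
  rewrite /= coef0 coef_sum (bigID (fun i => e i j0 == e0 j0)) /=.
  rewrite [X in _ + X]big1 ?addr0 => [E|i /andP[_ ne]]; last first.
    by rewrite coefZ coefXn eq_sym (negbTE ne) mulr0.
  rewrite -[RHS]E; apply: eq_big => [i|i /andP[/eqP <- _]]; first by rewrite andbC.
  rewrite coefZ coefXn eqxx mulr1.
  by congr (_ * _); apply: eq_bigl => j; rewrite inE negb_or andbC.
have h0 (j : J) : 0 < eps / 2 < eps.
  by rewrite divr_gt0 ?ltr0n //= ltr_pdivrMr ?ltr0n // ltr_pMr // ltr1n.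
rewrite -[RHS](K _ (enum_uniq J) (fun=> eps / 2) h0); apply: eq_big => [i|i _].
  apply/forallP/allP => [A j _|A j]; first exact: A.
  by apply: A; rewrite mem_enum.
by rewrite big_pred0 ?mulr1 // => j; rewrite mem_enum.
Qed.

Lemma mpoly_eq0_itv (R : realType) n (f : {mpoly R[n]}) (eps : R) : 0 < eps ->
  (forall h : 'I_n -> R, (forall j, 0 < h j < eps) -> f.@[h] = 0) -> f = 0.
Proof.
move=> eps0 H; apply/mpolyP => m; rewrite mcoeff0.
have := @sum_monomials_eq0 R _ 'I_n (msupp f) (fun m => f@_m)
  (fun m j => m j) eps eps0 _ (fun j => m j).
have EQ (m' : 'X_{1..n}) : [forall j, m' j == m j] = (m' == m).
  by apply/forallP/eqP => [E|-> //]; apply/mnmP => j; apply/eqP/E.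
rewrite big_mkcond => E; rewrite [f]mpolyE raddf_sum -[RHS]E => [|h h0] /=.
  apply: eq_bigr => m' _; rewrite EQ mcoeffZ mcoeffX.
  by case: eqP; rewrite ?mulr1 ?mulr0.
by rewrite -[RHS](H h h0) mevalE.
Qed.

(** * The tree and its labels *)

Section Vertices.
Variables (p : nat) (d : sizes p).
Implicit Types (V W D : {set 'I_p}) (x y z : outcome d) (c v w : poutcome d).
Implicit Types (j k : 'I_p) (m n : nat).

Definition prefix x m : poutcome d := restrict (below p m) x.

Lemma extends_restrict2 V W x y :
  extends (restrict V x) (restrict W y) = (V \subset W) && agree V x y.
Proof.
apply/forallP/andP => [H|[/subsetP sVW /agreeP xy] i].
  have K i : i \in V -> (i \in W) && (y i == x i).
    move=> Vi; have := H i; rewrite dom_restrict Vi !ffunE Vi.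
    by case: ifP => _ /eqP // [->]; rewrite eqxx.
  split; first by apply/subsetP=> i /K /andP[].
  by apply/agreeP=> i /K /andP[_ /eqP].
rewrite dom_restrict; apply/implyP=> Vi.
by rewrite !ffunE Vi sVW // xy.
Qed.

Lemma prefix_level x m : prefix x m \in level d m.
Proof. by rewrite inE dom_restrict. Qed.

Lemma level_prefix m v : v \in level d m -> v = prefix (fill v) m.
Proof.
by rewrite inE /prefix => /eqP <-; apply: restrict_extends; apply: extends_fill.
Qed.

Lemma prefix_nonleaf x j : prefix x j \in nonleaf d.
Proof. by apply/bigcupP; exists j => //; apply: prefix_level. Qed.

Lemma prefix_eq x y m : (prefix x m = prefix y m) <-> agree (below p m) x y.
Proof. exact: restrict_inj. Qed.

Lemma below_subset m n : (m <= n)%N -> below p m \subset below p n.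
Proof. by move=> mn; apply/subsetP=> i; rewrite !inE => /leq_trans; apply. Qed.

Lemma belowS k : below p k.+1 = below p k :|: [set k].
Proof.
by apply/setP=> i; rewrite !inE ltnS leq_eqVlt orbC -val_eqE.
Qed.

Lemma belowT m : (p <= m)%N -> below p m = setT.
Proof. by move=> pm; apply/setP=> i; rewrite !inE (leq_trans (ltn_ord i)). Qed.

Lemma below_inj (i j : 'I_p) : below p i = below p j -> i = j.
Proof.
move=> E; apply/eqP; rewrite -val_eqE /= eqn_leq; apply/andP; split; rewrite leqNgt;
  apply/negP => lt.
  by have /setP/(_ j) := E; rewrite !inE ltnn lt.
by have /setP/(_ i) := E; rewrite !inE ltnn lt.
Qed.

Lemma disjoint_below_set1 k : [disjoint below p k & [set k]].
Proof. by rewrite disjoint_sym disjoints1 inE ltnn. Qed.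

Lemma below_sub_setC1 k : below p k \subset ~: [set k].
Proof. by rewrite -disjoints_subset disjoint_below_set1. Qed.

Lemma prefix_edge x j : is_edge (prefix x j, prefix x j.+1).
Proof.
apply/existsP; exists j; rewrite !prefix_level extends_restrict2 agree_refl.
by rewrite below_subset.
Qed.

Definition edge_of x j : edge d :=
  exist (fun vw => is_edge vw) (prefix x j, prefix x j.+1) (prefix_edge x j).

Lemma edge_ofP (e : edge d) : exists x j, e = edge_of x j.
Proof.
have /existsP[j /and3P[vj wj vw]] := valP e.
exists (fill (tgt e)), j; apply: val_inj.
move: vj wj vw; rewrite /tgt; case: (val e) => v w /= vj wj vw.
rewrite -(level_prefix wj); congr (_, _).
move: vw; rewrite {1}(level_prefix wj) {1}(level_prefix vj) extends_restrict2.
by move=> /andP[_ /prefix_eq <-]; apply: level_prefix.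
Qed.

Lemma edge_of_eq x y i j :
  edge_of x i = edge_of y j <-> i = j /\ agree (below p i.+1) x y.
Proof.
split=> [E|[-> xy]]; last first.
  apply: val_inj; congr (_, _); apply/prefix_eq => //.
  by apply: agree_sub xy; apply: below_subset.
have [E1 E2] : prefix x i = prefix y j /\ prefix x i.+1 = prefix y j.+1.
  by have := congr1 val E => -[].
have Eij : i = j.
  by apply: below_inj; rewrite -(dom_restrict (below p i) x) -(dom_restrict (below p j)
    y) -/(prefix x i) E1.
by split=> //; apply/prefix_eq; rewrite E2 Eij.
Qed.

Lemma out_edgesE x k :
  out_edges (prefix x k) = [set edge_of z k | z in agree (~: [set k]) x].
Proof.
apply/setP=> e; rewrite inE; apply/eqP/imsetP => [|[z /= xz ->]]; last first.
  rewrite /src /=; apply/prefix_eq; apply: agree_sub (below_sub_setC1 k) _.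
  by rewrite agree_sym.
have [y [j ->]] := edge_ofP e; rewrite /src /= => E.
have Ejk : j = k.
  by apply: below_inj; rewrite -(dom_restrict (below p j) y) -(dom_restrict (below p k)
    x) -/(prefix y j) E.
move: E; rewrite Ejk => /prefix_eq yx; exists (mix [set k] x y).
  by rewrite -topredE /= agree_sym agree_mixl // disjoints_subset.
apply/edge_of_eq; split=> //; rewrite belowS agreeU; apply/andP; split.
  by apply: agree_mix; rewrite ?agree_refl.
by rewrite agree_sym agree_mixr.
Qed.

Lemma sum_out_edges (W : nmodType) x k (F : edge d -> W) :
  \sum_(e in out_edges (prefix x k)) F e
  = \sum_(z | agree (~: [set k]) x z) F (edge_of z k).
Proof.
rewrite out_edgesE big_imset //= => y z /= xy xz /edge_of_eq[_].
rewrite belowS agreeU => /andP[_ /agreeP yz]; apply/eqP; rewrite -agree_setT.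
rewrite -(setUCr [set k]) agreeU (agree_trans _ xz) ?andbT; last first.
  by rewrite agree_sym.
exact/agreeP.
Qed.

Lemma prod_path_edges (A : comPzRingType) x m (F : edge d -> A) :
  \prod_(e in path_edges (prefix x m) (full_outcome x)) F e
  = \prod_(j : 'I_p | (m <= j)%N) F (edge_of x j).
Proof.
have -> : path_edges (prefix x m) (full_outcome x)
    = [set edge_of x j | j in [pred j : 'I_p | (m <= j)%N]].
  apply/setP=> e; have [y [j ->]] := edge_ofP e.
  rewrite inE /src /tgt /= extends_restrict2 extends_restrict.
  apply/andP/imsetP => [[/andP[mj _] yx]|[i /= mi /edge_of_eq[-> yx]]].
    exists j; last exact/edge_of_eq.
    rewrite inE leqNgt; apply: contraL mj => jm.
    by apply/subsetPn; exists j; rewrite inE ?ltnn.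
  split=> //; rewrite below_subset // agree_sym.
  by apply: agree_sub yx; apply: below_subset; apply: leq_trans (leqnSn i).
by rewrite big_imset //= => i j _ _ /edge_of_eq[].
Qed.

End Vertices.

Section Labels.
Variables (p : nat) (d : sizes p) (L : finType) (T : cstree d L).
Implicit Types (x y z : outcome d) (c : poutcome d) (j k : 'I_p) (m : nat).

Definition lab x j : label T := label_of T (edge_of x j).

Definition stage_eq j x y : bool := floret T (prefix x j) == floret T (prefix y j).

Lemma labP (l : label T) : exists x j, l = lab x j.
Proof.
have /codomP[e le] := valP l; have [x [j ej]] := edge_ofP e.
by exists x, j; apply: val_inj; rewrite /= le ej.
Qed.

Lemma lab_agree x y j : agree (below p j.+1) x y -> lab x j = lab y j.
Proof. by move=> xy; congr label_of; apply/edge_of_eq. Qed.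

Lemma stage_eq_refl j x : stage_eq j x x.
Proof. exact: eqxx. Qed.

Lemma stage_eq_sym j x y : stage_eq j x y = stage_eq j y x.
Proof. exact: eq_sym. Qed.

Lemma stage_eq_trans j x y z : stage_eq j x y -> stage_eq j y z -> stage_eq j x z.
Proof. by move=> /eqP xy /eqP yz; apply/eqP; rewrite xy. Qed.

Lemma agree_stage_eq j x y : agree (below p j) x y -> stage_eq j x y.
Proof. by move=> /prefix_eq E; rewrite /stage_eq E. Qed.

Lemma same_stageE j x y : same_stage T (prefix x j) (prefix y j) = stage_eq j x y.
Proof. by rewrite /same_stage !prefix_nonleaf. Qed.

Lemma stage_eq_lab j x y : stage_eq j x y -> x j = y j -> lab x j = lab y j.
Proof.
move=> xy Exy; apply: val_inj => /=.
apply: (@cstree_labels _ _ _ T j); rewrite ?prefix_level ?same_stageE //.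
by rewrite /tgt /= !ffunE inE ltnSn Exy.
Qed.

Lemma lab_floret x j : val (lab x j) \in floret T (prefix x j).
Proof. by apply: imset_f; rewrite inE. Qed.

Lemma lab_level x y i j : lab x i = lab y j -> i = j.
Proof.
move=> E; apply/eqP/negPn/negP => ij.
have [_ disj] := cstree_staged T.
have [] := disj (prefix x i) (prefix y j) (prefix_nonleaf x i) (prefix_nonleaf y j).
  by apply: (@cstree_levels _ _ _ T i j); rewrite ?prefix_level.
by move/disjointFr => /(_ _ (lab_floret x i)); rewrite E lab_floret.
Qed.

Lemma floret_inj x j : {in out_edges (prefix x j) &, injective T}.
Proof.
have [card_fl _] := cstree_staged T.
by apply/imset_injP/eqP; apply: (card_fl _ (prefix_nonleaf x j)).
Qed.

Lemma lab_stage_eq x y j : lab x j = lab y j -> stage_eq j x y /\ x j = y j.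
Proof.
move=> E; have [_ disj] := cstree_staged T.
have xy : stage_eq j x y.
  apply/eqP; have [//|] := disj (prefix x j) (prefix y j)
    (prefix_nonleaf x j) (prefix_nonleaf y j).
  by move/disjointFr => /(_ _ (lab_floret x j)); rewrite E lab_floret.
split=> //; pose z := mix [set j] x y.
have zx : agree (below p j) z x.
  exact: agree_mixl (disjoint_below_set1 j).
have zj : z j = y j by rewrite mixE inE eqxx.
have Ezy : lab z j = lab y j.
  by apply: stage_eq_lab zj; apply: stage_eq_trans xy; apply: agree_stage_eq.
have : edge_of x j = edge_of z j.
  apply: (@floret_inj x j).
  - by rewrite inE.
  - by rewrite inE /src /=; apply/eqP/prefix_eq.
  - by have := congr1 val E; rewrite -Ezy.
by rewrite edge_of_eq => -[_ /agreeP xz]; rewrite xz ?zj // inE.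
Qed.

Definition toggle x : outcome d :=
  [ffun i => if x i == state0 d i then Ordinal (nstates_gt1 d i) else state0 d i].

Lemma toggleP x i : toggle x i <> x i.
Proof.
rewrite ffunE; case: eqP => [-> /(congr1 val)|nx] //.
by move=> E; apply: nx.
Qed.

Lemma stage_context j x : exists c : poutcome d,
  [/\ dom c \subset below p j,
      forall y, stage_eq j x y = extends c (full_outcome y)
    & stage_csi T (Csi [set j] (below p j :\: dom c) set0 c)].
Proof.
pose S := [set w | same_stage T (prefix x j) w].
have SE : S \in stages T by apply/imsetP; exists (prefix x j); rewrite ?prefix_nonleaf.
have Sj : S \subset level d j.
  apply/subsetP=> w; rewrite inE => /and3P[_ /bigcupP[k _ wk] /eqP xw].
  have [->//|jk] := eqVneq j k.
  by case: (@cstree_levels _ _ _ T j k (prefix x j) w) => //; apply: prefix_level.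
have [c cj SC] := cstree_stages SE Sj.
have SP y : stage_eq j x y = extends c (full_outcome y).
  rewrite -same_stageE; transitivity (prefix y j \in S); first by rewrite inE.
  rewrite SC inE prefix_level /=.
  rewrite (restrict_extends (extends_fill c)) extends_restrict2 extends_restrict.
  by rewrite cj.
exists c; split=> //; exists j, S, c; split=> // i a; split=> [ca w|Sa].
  rewrite SC inE => /andP[_ /forallP/(_ i)]; rewrite inE ca /= => /eqP ->//.
have xS : prefix x j \in S by rewrite inE same_stageE stage_eq_refl.
have xa := Sa _ xS.
have [ic|nic] := boolP (i \in dom c).
  have cx : extends c (full_outcome x) by rewrite -SP stage_eq_refl.
  move/extendsP: cx => /(_ i ic) ->; rewrite -xa.
  by rewrite ffunE (subsetP cj).
pose y := mix [set i] x (toggle x).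
have yS : prefix y j \in S.
  rewrite inE same_stageE SP; have := stage_eq_refl j x; rewrite SP => cx.
  by rewrite (extends_agree _ cx) agree_sym agree_mixl // disjoint_sym disjoints1.
have ij : i \in below p j.
  by apply: contraT => nij; move: xa; rewrite ffunE (negbTE nij).
have := Sa _ yS; rewrite -xa ffunE ij [RHS]ffunE ij mixE inE eqxx => -[].
by move/toggleP.
Qed.

End Labels.

Lemma eq_rmorph_mpoly (R A : comNzRingType) n (f g : {rmorphism {mpoly R[n]} -> A}) :
  (forall c, f c%:MP = g c%:MP) -> (forall i, f 'X_i = g 'X_i) -> f =1 g.
Proof.
move=> fgC fgX P; rewrite [P]mpolyE !rmorph_sum; apply: eq_bigr => m _.
rewrite -mul_mpolyC !rmorphM fgC; congr (_ * _).
rewrite mpolyXE_id !rmorph_prod; apply: eq_bigr => i _.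
by rewrite !rmorphXn fgX.
Qed.

(** * Evaluation of the label ring and the kernel of psi *)

Section TreePolynomials.
Variables (R : realType) (p : nat) (d : sizes p) (L : finType) (T : cstree d L).
Implicit Types (x y z : outcome d) (j k : 'I_p) (m : nat).
Local Notation label_poly := {mpoly R[#|{: label T}|]}.

Definition lvar (l : label T) : label_poly := 'X_(enum_rank l).

Definition tpoly_at m x : label_poly :=
  \sum_(y | agree (below p m) x y) \prod_(j : 'I_p | (m <= j)%N) lvar (lab T y j).

Lemma tpolyE m x : tpoly R T (prefix x m) = tpoly_at m x.
Proof.
rewrite /tpoly /tpoly_at; apply: eq_big => [y|y].
  exact: extends_restrict.
rewrite extends_restrict => /prefix_eq E.
by rewrite E prod_path_edges.
Qed.

Lemma child_prefix x z k : agree (below p k) x z ->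
  child (prefix x k) (z k) = prefix z k.+1.
Proof.
move=> /agreeP xz; apply/ffunP=> i; rewrite ffunE.
have [->|ik] := eqVneq i k; first by rewrite dfwith_in ffunE inE ltnSn.
rewrite dfwith_out 1?eq_sym // !ffunE !inE ltnS [in RHS]leq_eqVlt.
rewrite val_eqE (negbTE ik) /=; case: ifP => // lt_ik.
by rewrite xz // inE.
Qed.

Lemma agree_below_mix k m x y : (m <= k)%N -> agree (below p m) x (mix [set k] x y).
Proof.
move=> mk; rewrite agree_sym; apply: agree_mixl.
by rewrite disjoint_sym disjoints1 inE -leqNgt.
Qed.

Lemma balancedP : balanced R T <-> forall k x y, stage_eq T k x y ->
  tpoly_at k.+1 x * tpoly_at k.+1 y = tpoly_at k.+1 (mix [set k] x y) * tpoly_at k.+1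
    (mix [set k] y x).
Proof.
have childE k x y : child (prefix x k) (y k) = prefix (mix [set k] x y) k.+1.
  by rewrite -(child_prefix (agree_below_mix x y (leqnn k))) mixE inE eqxx.
have child_refl k x : child (prefix x k) (x k) = prefix x k.+1.
  by apply: child_prefix; apply: agree_refl.
split=> [H k x y xy|H k v w vk wk vw s r].
  rewrite -!tpolyE -!childE -!child_refl.
  by apply: H; rewrite ?prefix_level ?same_stageE.
have [x [Ev ->]] : exists x, v = prefix x k /\ s = x k.
  exists (mix [set k] (fill v) (fill (child v s))); split.
    by rewrite {1}(level_prefix vk); apply/prefix_eq/agree_below_mix.
  by rewrite mixE inE eqxx !ffunE dfwith_in.
have [y [Ew ->]] : exists y, w = prefix y k /\ r = y k.
  exists (mix [set k] (fill w) (fill (child w r))); split.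
    by rewrite {1}(level_prefix wk); apply/prefix_eq/agree_below_mix.
  by rewrite mixE inE eqxx !ffunE dfwith_in.
move: vw; rewrite Ev Ew same_stageE !child_refl !childE !tpolyE.
exact: H.
Qed.

Lemma tpoly_rec k x : tpoly_at k x
  = \sum_(z | agree (~: [set k]) x z) lvar (lab T z k) * tpoly_at k.+1 z.
Proof.
rewrite /tpoly_at (sum_agree _ _ (disjoint_below_set1 k)).
apply: eq_bigr => z xz; rewrite -belowS mulr_sumr; apply: eq_bigr => y zy.
rewrite (bigD1 k) //= (lab_agree T zy); congr (_ * _).
by apply: eq_bigl => j; rewrite ltn_neqAle andbC eq_sym.
Qed.

Definition weight (h : label T -> R) x : R := \prod_j h (lab T x j).

Definition sums_to_one (h : label T -> R) : Prop :=
  forall x j, \sum_(z | agree (~: [set j]) x z) h (lab T z j) = 1.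

Definition leval (h : label T -> R) : {rmorphism label_poly -> R} :=
  meval (fun i => h (enum_val i)).

Lemma leval_lvar h l : leval h (lvar l) = h l.
Proof. by rewrite /= mevalXU enum_rankK. Qed.

Definition oeval (v : outcome d -> R) : {rmorphism {mpoly R[#|{: outcome d}|]} -> R} :=
  meval (fun i => v (enum_val i)).

Lemma oeval_pvar v x : oeval v (pvar R x) = v x.
Proof. by rewrite /= mevalXU enum_rankK. Qed.

Lemma sum_to_oneE (g : label_ring R T) :
  sum_to_one g <-> exists x j,
    g = \sum_(z | agree (~: [set j]) x z) lvar (lab T z j) - 1.
Proof.
split=> [[v /bigcupP[j _ vj] ->]|[x [j ->]]].
  by exists (fill v), j; rewrite {1}(level_prefix vj) sum_out_edges.
by exists (prefix x j); rewrite ?prefix_nonleaf // sum_out_edges.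
Qed.

Lemma theta_pi_eq0 (g : label_ring R T) :
  theta_pi R T g = 0 <-> ideal_gen (@sum_to_one R p d L T) g.
Proof.
rewrite -(rmorph0 (theta_pi R T)); split.
  move=> E; apply/asboolP; rewrite -/(theta_ideal g).
  have : g - 0 \in theta_idealr R T by rewrite Quotient.idealrBE; apply/eqP.
  by rewrite subr0.
move=> /asboolP Ig; apply/eqP.
have := Quotient.idealrBE (theta_idealr R T) g 0; rewrite subr0 => <-.
exact: Ig.
Qed.

End TreePolynomials.

Section Evaluation.
Variables (R : realType) (p : nat) (d : sizes p) (L : finType) (T : cstree d L).
Implicit Types (x y z : outcome d) (j k : 'I_p) (m : nat) (l : label T).
Implicit Types (h : label T -> R).

Definition floret_of x j : {set label T} := [set lab T z j | z in agree (~: [set j]) x].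

Lemma lab_floret_of x j : lab T x j \in floret_of x j.
Proof. by apply: imset_f; apply: agree_refl. Qed.

Lemma floret_of_stage x y j : stage_eq T j x y -> floret_of x j = floret_of y j.
Proof.
suff sub u v : stage_eq T j u v -> floret_of u j \subset floret_of v j.
  by move=> xy; apply/eqP; rewrite eqEsubset !sub // stage_eq_sym.
move=> uv; apply/subsetP=> _ /imsetP[z /= uz ->].
apply/imsetP; exists (mix [set j] v z).
  by rewrite -topredE /= agree_sym agree_mixl // disjoints_subset.
apply: stage_eq_lab; last by rewrite mixE inE eqxx.
apply: (@stage_eq_trans _ _ _ _ _ _ u).
  apply: agree_stage_eq; rewrite agree_sym.
  exact: agree_sub (below_sub_setC1 j) uz.
apply: stage_eq_trans uv _; apply: agree_stage_eq.
exact: agree_below_mix.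
Qed.

Lemma sum_floret (W : nmodType) (F : label T -> W) x j :
  \sum_(z | agree (~: [set j]) x z) F (lab T z j) = \sum_(l in floret_of x j) F l.
Proof.
rewrite big_imset //= => y z /= xy xz /lab_stage_eq[_ yz].
apply/eqP; rewrite -agree_setT -(setUCr [set j]) agreeU (agree_trans _ xz).
  by rewrite andbT; apply/agreeP=> i; rewrite inE => /eqP->.
by rewrite agree_sym.
Qed.

Definition floret_lab l : {set label T} :=
  let w := cid (labP l) in floret_of (sval w) (sval (cid (svalP w))).

Lemma floret_labE x j l : l \in floret_of x j -> floret_lab l = floret_of x j.
Proof.
rewrite /floret_lab; case: cid => u ul /=; case: cid => i /= -> {ul l}.
case/imsetP=> z /= xz E; have Eij := lab_level E; rewrite Eij in E *.
have [uz _] := lab_stage_eq E; apply: floret_of_stage.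
apply: stage_eq_trans uz _; apply: agree_stage_eq; rewrite agree_sym.
exact: agree_sub (below_sub_setC1 j) xz.
Qed.

Definition marked l : bool := [pick l' in floret_lab l] == Some l.

(* [close h] keeps the values of [h], except that on one marked label of each
   floret it takes the value that makes the floret sum to one. *)
Definition close (A : comNzRingType) (h : label T -> A) l : A :=
  if marked l then 1 - \sum_(l' in floret_lab l | l' != l) h l' else h l.

Lemma sum_close (A : comNzRingType) (h : label T -> A) x j :
  \sum_(l in floret_of x j) close h l = 1.
Proof.
case E: [pick l' in floret_of x j] => [l0|]; last first.
  by move: E; case: pickP => // /(_ (lab T x j)); rewrite lab_floret_of.
have l0F : l0 \in floret_of x j by move: E; case: pickP => // l lF [<-].
have markE l : l \in floret_of x j -> marked l = (l == l0).
  by move=> lF; rewrite /marked (floret_labE lF) E eq_sym.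
rewrite (bigD1 l0) //= {1}/close markE // eqxx (floret_labE l0F).
rewrite (eq_bigr h) ?subrK // => l /andP[lF /negbTE ne].
by rewrite /close markE // ne.
Qed.

Lemma close_sums_to_one h : sums_to_one (close h).
Proof. by move=> x j; rewrite sum_floret sum_close. Qed.

Lemma close_gt0 h : (forall l, 0 < h l < #|{: label T}|.+1%:R^-1) ->
  forall l, 0 < close h l.
Proof.
move=> h0 l; rewrite /close; case: ifP => _; last by case/andP: (h0 l).
rewrite subr_gt0; set N := #|{: label T}|.
apply: (@le_lt_trans _ _ (N%:R / N.+1%:R)); last first.
  by rewrite ltr_pdivrMr ?ltr0n // mul1r ltr_nat.
apply: (@le_trans _ _ (\sum_(l' in floret_lab l | l' != l) N.+1%:R^-1)).
  by apply: ler_sum => l' _; case/andP: (h0 l') => _ /ltW.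
rewrite sumr_const -[X in X <= _]mulr_natl ler_wpM2r ?invr_ge0 ?ler0n //.
by rewrite ler_nat max_card.
Qed.

Lemma leval_sum_to_one (g : label_ring R T) h : sums_to_one h ->
  theta_pi R T g = 0 -> leval h g = 0.
Proof.
move=> h1 /theta_pi_eq0[n [a [b [bP ->]]]].
rewrite rmorph_sum big1 // => i _; rewrite rmorphM.
have [x [j ->]] := (sum_to_oneE _).1 (bP i).
rewrite rmorphB rmorph1 rmorph_sum (eq_bigr (fun z => h (lab T z j))) => [|z _].
  by rewrite h1 subrr mulr0.
by rewrite leval_lvar.
Qed.

Lemma theta_pi_vanish (g : label_ring R T) :
  (forall h, (forall l, 0 < h l) -> sums_to_one h -> leval h g = 0) ->
  theta_pi R T g = 0.
Proof.
move=> H.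
pose s : {rmorphism {mpoly R[#|{: label T}|]} -> {mpoly R[#|{: label T}|]}} :=
  mmap (@mpolyC _ R) (fun i => close (@lvar R p d L T) (enum_val i)).
have sE l : s (lvar R l) = close (@lvar R p d L T) l.
  by rewrite /= mmapX mmap1U enum_rankK.
have piE : theta_pi R T \o s =1 theta_pi R T.
  apply: eq_rmorph_mpoly => [c|i]; first by rewrite /= mmapC.
  rewrite -[i]enum_valK -/(lvar R (enum_val i)) /=; set l := enum_val i.
  rewrite -[mmap _ _ _]/(s (lvar R l)) sE /close; case: ifP => // _.
  have [x [j lE]] := labP l.
  have lF : l \in floret_of x j by rewrite lE lab_floret_of.
  rewrite (floret_labE lF).
  have : theta_pi R T (\sum_(l' in floret_of x j) lvar R l' - 1) = 0.
    apply/theta_pi_eq0; exists 1%N, (fun=> 1), (fun=> \sum_(l' in floret_of x j) lvar R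
      l' - 1).
    split; last by rewrite big_ord1 mul1r.
    by move=> _; apply/sum_to_oneE; exists x, j; rewrite sum_floret.
  rewrite (bigD1 l) //= -addrA => /eqP; rewrite rmorphD addr_eq0 -rmorphN opprB.
  by move/eqP.
have s0 : s g = 0.
  apply: (@mpoly_eq0_itv R _ _ #|{: label T}|.+1%:R^-1); first by rewrite invr_gt0 ltr0n.
  move=> h h0; pose h' l := h (enum_rank l).
  transitivity (leval (close h') g); last first.
    apply: H; last exact: close_sums_to_one.
    by apply: close_gt0 => l; apply: h0.
  transitivity (leval h' (s g)).
    by apply: meval_eq => i; rewrite /h' enum_valK.
  rewrite -[LHS]/((leval h' \o s) g); apply: eq_rmorph_mpoly => [c|i].
    by rewrite /= mmapC !mevalC.
  rewrite -[i]enum_valK -/(lvar R (enum_val i)) leval_lvar.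
  rewrite -[LHS]/(leval h' (s _)) sE /close; case: ifP => _; last exact: leval_lvar.
  rewrite rmorphB rmorph1 rmorph_sum; congr (_ - _).
  by apply: eq_bigr => l _; rewrite leval_lvar.
by rewrite -piE /= -[mmap _ _ _]/(s g) s0 rmorph0.
Qed.

End Evaluation.

Section Kernel.
Variables (R : realType) (p : nat) (d : sizes p) (L : finType) (T : cstree d L).
Implicit Types (x y z : outcome d) (h : label T -> R).

Definition scaled (t : R) h x : R := t * weight h x.

Definition psi_lift : {rmorphism {mpoly R[#|{: outcome d}|]} ->
  {poly {mpoly R[#|{: label T}|]}}} :=
  mmap (polyC \o @mpolyC _ R)
    (fun i => 'X * (\prod_j lvar R (lab T (enum_val i) j))%:P).

Lemma psi_liftE f : psi R T f = map_poly (theta_pi R T) (psi_lift f).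
Proof.
rewrite -[RHS]/((map_poly (theta_pi R T) \o psi_lift) f).
apply: eq_rmorph_mpoly => [c|i].
  by rewrite /= !mmapC /= map_polyC.
rewrite /= !mmapX !mmap1U rmorphM /= map_polyX map_polyC /=.
set x := enum_val i; have -> : tree_root d = prefix x 0.
  by apply/ffunP=> k; rewrite !ffunE inE.
by rewrite prod_path_edges.
Qed.

Lemma leval_psi_lift h f t :
  (map_poly (leval h) (psi_lift f)).[t] = oeval (scaled t h) f.
Proof.
rewrite -[LHS]/((horner_eval t \o map_poly (leval h) \o psi_lift) f).
apply: eq_rmorph_mpoly => [c|i].
  by rewrite /= !mmapC /= map_polyC /horner_eval hornerC /= !mevalC.
rewrite /= !mmapX !mmap1U rmorphM /= map_polyX map_polyC /horner_eval.
rewrite hornerM hornerX hornerC -[X in _ * X = _]/(leval h _) rmorph_prod mevalXU;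
  congr (_ * _).
by apply: eq_bigr => j _; rewrite leval_lvar.
Qed.

Lemma ker_psiP f : ker_psi T f <-> forall h t, (forall l, 0 < h l) ->
  sums_to_one h -> 0 < t -> oeval (scaled t h) f = 0.
Proof.
rewrite /ker_psi psi_liftE; split=> [E h t h0 h1 t0|H].
  rewrite -leval_psi_lift (_ : map_poly _ _ = 0) ?horner0 //.
  apply/polyP=> n; rewrite coef_map coef0 /=; apply: leval_sum_to_one => //.
  by rewrite -coef_map E coef0.
apply/polyP=> n; rewrite coef_map coef0; apply: theta_pi_vanish => h h0 h1.
rewrite -coef_map (_ : map_poly _ _ = 0) ?coef0 //.
apply: (poly_eq0_itv ltr01) => t /andP[t0 _].
by rewrite leval_psi_lift H.
Qed.

End Kernel.

(** * Soundness of the CSI axioms *)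

Section Statements.
Variables (p : nat) (d : sizes p).
Implicit Types (A B S U : {set 'I_p}) (c : poutcome d).

Lemma dom_join c c' : dom (join c c') = dom c :|: dom c'.
Proof. by apply/setP=> i; rewrite !inE ffunE inE; case: (c i). Qed.

Lemma disjoint_pointwise A B :
  [disjoint A & B] <-> forall i, ~~ ((i \in A) && (i \in B)).
Proof.
rewrite -setI_eq0; split=> [/eqP/setP E i|H].
  by have := E i; rewrite !inE => ->.
by apply/eqP/setP=> i; rewrite !inE; apply/negbTE.
Qed.

Lemma wf_csiP A B S c : wf_csi (Csi A B S c) <->
  forall i, ((i \in A) + (i \in B) + (i \in S) + (i \in dom c) <= 1)%N.
Proof.
rewrite /wf_csi /=; split.
  case/and4P; rewrite !disjoint_pointwise => AB AS BS D i.
  have := AB i; have := AS i; have := BS i; have := D i; rewrite !in_setU.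
  by do ![case: (_ \in _)].
move=> H; apply/and4P; split; apply/disjoint_pointwise=> i; have := H i;
  rewrite ?in_setU; by do ![case: (_ \in _)].
Qed.

Lemma wf_specialization A B S c x : dom x \subset S -> wf_csi (Csi A B S c) ->
  [/\ [disjoint dom x & dom c], S :\: dom x :|: dom (join x c) = S :|: dom c
    & wf_csi (Csi A B (S :\: dom x) (join x c))].
Proof.
move=> /subsetP xS /wf_csiP wf; split.
- apply/disjoint_pointwise=> i; apply/negP=> /andP[/xS iS ic].
  by have := wf i; rewrite iS ic; do ![case: (_ \in _)].
- rewrite dom_join setUA; congr (_ :|: _); apply/setP=> i.
  rewrite in_setU in_setD.
  by case: (boolP (i \in dom x)) => [/xS ->|] /=; rewrite ?orbF.
- apply/wf_csiP=> i; have := wf i; rewrite dom_join in_setU in_setD.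
  have := xS i; case: (i \in dom x); last by [].
  by move=> -> //; do ![case: (_ \in _)].
Qed.

Lemma wf_absorption A B S U c : [disjoint U & dom c] ->
  (forall x, dom x = U -> wf_csi (Csi A B S (join x c))) -> wf_csi (Csi A B (S :|: U) c).
Proof.
move=> Uc wf; apply/wf_csiP=> i.
have := wf _ (dom_restrict U [ffun i => state0 d i]).
move/wf_csiP/(_ i); move/disjoint_pointwise/(_ i): Uc.
by rewrite dom_join dom_restrict !in_setU; do ![case: (_ \in _)].
Qed.

Lemma extends_join c c' (x : outcome d) : [disjoint dom c & dom c'] ->
  extends (join c c') (full_outcome x)
  = extends c (full_outcome x) && extends c' (full_outcome x).
Proof.
move=> dcc'; apply/extendsP/andP => [H|[/extendsP H /extendsP H'] i].
  split; apply/extendsP=> i ic; have := H i; rewrite dom_join inE ic ?orbT ffunE.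
    by rewrite ic => ->.
  by rewrite (disjointFl dcc' ic) => ->.
by rewrite dom_join inE ffunE; case: ifP => [/H -> //|_ /= /H'].
Qed.

Lemma extends_join_restrict c U (x : outcome d) : [disjoint U & dom c] ->
  extends c (full_outcome x) -> extends (join (restrict U x) c) (full_outcome x).
Proof.
by move=> dUc cx; rewrite extends_join ?dom_restrict // extends_restrict agree_refl.
Qed.

End Statements.

Section Independence.
Variables (R : realType) (p : nat) (d : sizes p).
Implicit Types (A B S U V W E : {set 'I_p}) (c : poutcome d) (x y z : outcome d).
Variable q : outcome d -> R.
Hypothesis q_gt0 : forall x, 0 < q x.

Definition marginal V x : R := \sum_(y | agree V x y) q y.

Lemma marginal_gt0 V x : 0 < marginal V x.
Proof.
rewrite /marginal (bigD1 x) ?agree_refl //= ltr_wpDr // sumr_ge0 // => y _.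
exact: ltW.
Qed.

Lemma marginal_neq0 V x : marginal V x != 0.
Proof. by rewrite gt_eqF ?marginal_gt0. Qed.

Lemma marginal_agree V x y : agree V x y -> marginal V x = marginal V y.
Proof.
move=> xy; apply: eq_bigl => z; apply/idP/idP; apply: agree_trans => //.
by rewrite agree_sym.
Qed.

Lemma marginalT x : marginal setT x = q x.
Proof. by rewrite /marginal (big_pred1 x) // => y; rewrite agree_setT eq_sym. Qed.

Lemma marginal_sum V E x : [disjoint V & E] ->
  marginal V x = \sum_(z | agree (~: E) x z) marginal (V :|: E) z.
Proof. by move=> VE; rewrite /marginal (sum_agree _ _ VE). Qed.

Definition csi_holds (st : csi d) : Prop :=
  forall x, extends (ctx st) (full_outcome x) ->
  let W := cond st :|: dom (ctx st) in
  marginal (lhs st :|: rhs st :|: W) x * marginal W x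
  = marginal (lhs st :|: W) x * marginal (rhs st :|: W) x.

Lemma holds_symmetry A B S c : csi_holds (Csi A B S c) -> csi_holds (Csi B A S c).
Proof. by move=> H x /H /= E; rewrite [B :|: A]setUC E mulrC. Qed.

Lemma agree_compl V E x z : [disjoint V & E] -> agree (~: E) x z -> agree V x z.
Proof. by move=> dVE; apply: agree_sub; rewrite -disjoints_subset. Qed.

Lemma holds_decomposition A B D S c : wf_csi (Csi A (B :|: D) S c) ->
  [disjoint B & D] -> csi_holds (Csi A (B :|: D) S c) -> csi_holds (Csi A B S c).
Proof.
move=> /wf_csiP wf BD H x cx /=; set W := S :|: dom c.
have dD V : V \subset A :|: B :|: W -> [disjoint V & D].
  move=> /subsetP sV; apply/disjoint_pointwise=> i; apply/negP=> /andP[/sV Vi Di].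
  move/disjoint_pointwise: BD => /(_ i); have := wf i; move: Vi.
  rewrite !in_setU Di; by do ![case: (_ \in _)].
rewrite (marginal_sum (E := D)) ?dD // (marginal_sum (V := B :|: W) (E := D)); last first.
  by apply: dD; apply/subsetP=> i; rewrite !inE -!orbA => ->; rewrite orbT.
rewrite mulr_suml mulr_sumr; apply: eq_bigr => z xz.
rewrite -/W (marginal_agree (V := W) (y := z)); last first.
  by apply: agree_compl xz; apply: dD; apply/subsetP=> i; rewrite !inE => ->;
    rewrite orbT.
rewrite (marginal_agree (V := A :|: W) (y := z)); last first.
  apply: agree_compl xz; apply: dD; apply/subsetP=> i; rewrite !inE.
  by do ![case: (_ \in _)].
have /H /= : extends c (full_outcome z).
  rewrite (extends_agree _ cx); apply: agree_compl xz.
  by apply: dD; apply/subsetP=> i; rewrite !inE => ->; rewrite !orbT.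
by rewrite -/W !setUA -!(setUAC _ D) => ->.
Qed.

Lemma holds_weak_union A B D S c : wf_csi (Csi A (B :|: D) S c) ->
  [disjoint B & D] -> csi_holds (Csi A (B :|: D) S c) -> csi_holds (Csi A B (S :|: D) c).
Proof.
move=> wf BD H x cx /=; set W := S :|: dom c.
have H1 := H x cx; move: (H1); rewrite /= -/W => {}H1.
have H2 : csi_holds (Csi A D S c).
  apply: holds_decomposition (_ : csi_holds (Csi A (D :|: B) S c));
    rewrite ?[D :|: B]setUC //.
  by rewrite disjoint_sym.
have := H2 x cx; rewrite /= -/W => {}H2.
have -> : S :|: D :|: dom c = D :|: W by rewrite setUAC setUC.
rewrite !setUA -setUA in H1 H2 *.
apply: (mulIf (marginal_neq0 W x)); move: H1 H2; rewrite -!setUA => H1 H2.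
by rewrite mulrAC H1 [RHS]mulrAC H2 [RHS]mulrAC.
Qed.

Lemma holds_contraction A B D S c :
  csi_holds (Csi A B (S :|: D) c) -> csi_holds (Csi A D S c) ->
  csi_holds (Csi A (B :|: D) S c).
Proof.
move=> H1 H2 x cx /=; set W := S :|: dom c.
have := H1 x cx; have := H2 x cx; rewrite /= -/W => {}H2.
have -> : S :|: D :|: dom c = D :|: W by rewrite setUAC setUC.
rewrite !setUA => {}H1.
apply: (mulIf (marginal_neq0 (D :|: W) x)); move: H1 H2; rewrite -!setUA => H1 H2.
by rewrite mulrAC H1 mulrAC H2 -!mulrA [X in _ * X]mulrC.
Qed.

Lemma holds_intersection A B D S c : wf_csi (Csi A B (S :|: D) c) ->
  [disjoint S & D] -> csi_holds (Csi A B (S :|: D) c) ->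
  csi_holds (Csi A S (B :|: D) c) -> csi_holds (Csi A (B :|: S) D c).
Proof.
move=> /wf_csiP wf SD H1 H2 x cx /=; set W := D :|: dom c.
have dS V : V \subset A :|: B :|: W -> [disjoint V & S].
  move=> /subsetP sV; apply/disjoint_pointwise=> i; apply/negP=> /andP[/sV Vi Si].
  move/disjoint_pointwise: SD => /(_ i); have := wf i; move: Vi.
  rewrite !in_setU Si; by do ![case: (_ \in _)].
have {}H1 z : extends c (full_outcome z) ->
    marginal (A :|: (B :|: (S :|: W))) z * marginal (S :|: W) z
    = marginal (A :|: (S :|: W)) z * marginal (B :|: (S :|: W)) z.
  by move=> /H1 /=; rewrite -!setUA.
have {}H2 z : extends c (full_outcome z) ->
    marginal (A :|: (B :|: (S :|: W))) z * marginal (B :|: W) z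
    = marginal (A :|: (B :|: W)) z * marginal (B :|: (S :|: W)) z.
  by move=> /H2 /=; rewrite -!setUA [S :|: (B :|: _)]setUCA.
have H3 z : extends c (full_outcome z) ->
    marginal (A :|: (S :|: W)) z * marginal (B :|: W) z
    = marginal (A :|: (B :|: W)) z * marginal (S :|: W) z.
  move=> cz; apply: (mulIf (marginal_neq0 (B :|: (S :|: W)) z)).
  by rewrite mulrAC -H1 // [RHS]mulrAC -H2 // mulrAC.
have H4 : marginal (A :|: W) x * marginal (B :|: W) x
    = marginal (A :|: (B :|: W)) x * marginal W x.
  rewrite (@marginal_sum (A :|: W) S) ?(@marginal_sum W S).
  - rewrite mulr_suml mulr_sumr; apply: eq_bigr => z xz.
    rewrite -[A :|: W :|: S]setUA ![W :|: S]setUC.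
    rewrite (@marginal_agree (B :|: W) x z); last first.
      by apply: agree_compl xz; apply: dS; apply/subsetP=> i; rewrite !inE;
        do ![case: (_ \in _)].
    rewrite (@marginal_agree (A :|: (B :|: W)) x z); last first.
      by apply: agree_compl xz; apply: dS; rewrite setUA.
    apply: H3; rewrite (extends_agree _ cx); apply: agree_compl xz.
    by apply: dS; apply/subsetP=> i; rewrite !inE => ->; rewrite !orbT.
  - by apply: dS; apply/subsetP=> i; rewrite !inE; do ![case: (_ \in _)].
  - by apply: dS; apply/subsetP=> i; rewrite !inE; do ![case: (_ \in _)].
rewrite -!setUA; apply: (mulIf (marginal_neq0 (B :|: W) x)).
by rewrite mulrAC H2 // mulrAC -H4 mulrAC.
Qed.

Lemma derivable_sound (P : csi d -> Prop) :
  (forall st, P st -> wf_csi st /\ csi_holds st) ->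
  forall st, derivable P st -> wf_csi st /\ csi_holds st.
Proof.
move=> PH st; elim=> {st}.
- exact: PH.
- move=> A B S c _ [/wf_csiP wf H]; split; last exact: holds_symmetry.
  by apply/wf_csiP=> i; rewrite [(_ + (i \in A))%N]addnC.
- move=> A B D S c BD _ [wf H]; split; last exact: holds_decomposition wf BD H.
  apply/wf_csiP=> i; move/wf_csiP/(_ i): wf; rewrite in_setU.
  by do ![case: (_ \in _)].
- move=> A B D S c BD _ [wf H]; split; last exact: holds_weak_union wf BD H.
  apply/wf_csiP=> i; move/wf_csiP/(_ i): wf; move/disjoint_pointwise/(_ i): BD.
  by rewrite !in_setU; do ![case: (_ \in _)].
- move=> A B D S c SD _ [wf1 H1] _ [wf2 H2]; split; last exact: holds_contraction.
  apply/wf_csiP=> i; move/wf_csiP/(_ i): wf1; move/wf_csiP/(_ i): wf2.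
  move/disjoint_pointwise/(_ i): SD.
  by rewrite !in_setU; do ![case: (_ \in _)].
- move=> A B D S c SD BD _ [wf1 H1] _ [wf2 H2].
  split; last exact: holds_intersection wf1 SD H1 H2.
  apply/wf_csiP=> i; move/wf_csiP/(_ i): wf1; move/wf_csiP/(_ i): wf2.
  move/disjoint_pointwise/(_ i): SD; move/disjoint_pointwise/(_ i): BD.
  by rewrite !in_setU; do ![case: (_ \in _)].
- move=> A B S c x xS _ [wf H]; have [xc E wf'] := wf_specialization xS wf.
  by split=> // z; rewrite extends_join // => /andP[_ /H]; rewrite /= E.
- move=> A B S c U Uc _ IH; split; first by apply: wf_absorption => // x /IH[].
  move=> z cz; have [_ H] := IH _ (dom_restrict U z).
  have := H z (extends_join_restrict Uc cz).
  by rewrite /= dom_join dom_restrict -!setUA.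
Qed.

Lemma holds_saturated st : wf_csi st -> saturated st -> csi_holds st ->
  forall x y, extends (ctx st) (full_outcome x) -> extends (ctx st) (full_outcome y) ->
  {in cond st, forall i, x i = y i} ->
  q x * q y = q (mix (rhs st) x y) * q (mix (lhs st) x y).
Proof.
case: st => A B S c wf /eqP sat H x y cx cy /= xyS.
have {}sat : A :|: B :|: (S :|: dom c) = setT by rewrite setUA.
set W := S :|: dom c in sat.
have xyW : agree W x y.
  by rewrite agreeU -(extends_agree _ cx) cy andbT; apply/agreeP.
have {}H z : extends c (full_outcome z) ->
    q z * marginal W z = marginal (A :|: W) z * marginal (B :|: W) z.
  by move=> /H /=; rewrite -/W sat marginalT.
have dAB : [disjoint A & B].
  by case/and4P: wf.
have cBx := extends_mix B cx cy; have cAx := extends_mix A cx cy.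
have aB V : V \subset A -> agree V (mix B x y) x.
  by move=> VA; apply: agree_mixl; apply: disjointWl VA dAB.
have aW D z : agree W z x -> agree W z (mix D x y).
  by move=> zx; apply: agree_mix => //; apply: agree_trans xyW.
have W0 := marginal_neq0 W x.
apply: (mulIf (mulf_neq0 W0 W0)).
have E1 : marginal W (mix B x y) = marginal W x.
  by apply: marginal_agree; rewrite agree_sym aW ?agree_refl.
have E2 : marginal W (mix A x y) = marginal W x.
  by apply: marginal_agree; rewrite agree_sym aW ?agree_refl.
have E3 : marginal W y = marginal W x.
  by apply: marginal_agree; rewrite agree_sym.
have Ey := H y cy; have EB := H _ cBx; have EA := H _ cAx.
rewrite E3 in Ey; rewrite E1 in EB; rewrite E2 in EA.
rewrite mulrACA H // Ey [RHS]mulrACA EB EA.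
have -> : marginal (A :|: W) (mix B x y) = marginal (A :|: W) x.
  apply: marginal_agree; rewrite agreeU aB //=.
  by rewrite agree_sym aW ?agree_refl.
have -> : marginal (B :|: W) (mix B x y) = marginal (B :|: W) y.
  apply: marginal_agree; rewrite agreeU agree_mixr //=.
  by apply: agree_trans xyW; rewrite agree_sym aW ?agree_refl.
have -> : marginal (A :|: W) (mix A x y) = marginal (A :|: W) y.
  apply: marginal_agree; rewrite agreeU agree_mixr //=.
  by apply: agree_trans xyW; rewrite agree_sym aW ?agree_refl.
have -> : marginal (B :|: W) (mix A x y) = marginal (B :|: W) x.
  apply: marginal_agree; rewrite agreeU agree_mixl 1?disjoint_sym //=.
  by rewrite agree_sym aW ?agree_refl.
by rewrite mulrACA [RHS]mulrACA [X in _ = _ * X]mulrC.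
Qed.

End Independence.

Section Weights.
Variables (R : realType) (p : nat) (d : sizes p) (L : finType) (T : cstree d L).
Implicit Types (x y z : outcome d) (j k : 'I_p) (a h : label T -> R) (c : poutcome d).

Lemma prod_belowS (A : comPzRingType) (F : 'I_p -> A) k :
  \prod_(j : 'I_p | (j < k.+1)%N) F j = F k * \prod_(j : 'I_p | (j < k)%N) F j.
Proof.
rewrite (bigD1 k) //=; congr (_ * _); apply: eq_bigl => j.
by rewrite ltnS andbC -val_eqE ltn_neqAle.
Qed.

Lemma tpoly_agree m x y : agree (below p m) x y -> tpoly_at R T m x = tpoly_at R T m y.
Proof. by move=> /prefix_eq E; rewrite -!tpolyE E. Qed.

Lemma tpoly_top m x : (p <= m)%N -> tpoly_at R T m x = 1.
Proof.
move=> pm; rewrite /tpoly_at belowT // (big_pred1 x) => [|y];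
  last by rewrite agree_setT eq_sym.
by rewrite big_pred0 // => j; rewrite leqNgt (leq_trans (ltn_ord j)).
Qed.

Lemma leval_tpoly_gt0 a m x : (forall l, 0 < a l) -> 0 < leval a (tpoly_at R T m x).
Proof.
move=> a0; have P y : 0 < leval a (\prod_(j : 'I_p | (m <= j)%N) lvar R (lab T y j)).
  by rewrite rmorph_prod prodr_gt0 // => j _; rewrite leval_lvar.
rewrite rmorph_sum (bigD1 x) ?agree_refl // ltr_wpDr ?P // sumr_ge0 // => y _.
exact: ltW.
Qed.

Lemma tpoly_neq0 m x : tpoly_at R T m x != 0.
Proof.
apply: contraTneq (@leval_tpoly_gt0 (fun=> 1) m x _) => [->|//].
by rewrite rmorph0 ltxx.
Qed.

Lemma marginal_below a m x : marginal (weight a) (below p m) x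
  = (\prod_(j : 'I_p | (j < m)%N) a (lab T x j)) * leval a (tpoly_at R T m x).
Proof.
rewrite rmorph_sum mulr_sumr; apply: eq_bigr => y xy.
rewrite /weight (bigID (fun j : 'I_p => (j < m)%N)) /=; congr (_ * _).
  apply: eq_bigr => j jm; rewrite (@lab_agree _ _ _ T x y) //.
  by apply: agree_sub xy; apply: below_subset.
rewrite rmorph_prod; apply: eq_big => [j|j _]; first by rewrite -leqNgt.
by rewrite leval_lvar.
Qed.

Lemma sum_to_one_tpoly h m x : sums_to_one h -> leval h (tpoly_at R T m x) = 1.
Proof.
move=> h1; have [pm|/ltnW mp] := leqP p m; first by rewrite tpoly_top ?rmorph1.
move: x; rewrite -(subKn mp); elim: (p - m)%N => [|n IHn] x.
  by rewrite subn0 tpoly_top ?rmorph1.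
have [pn|np] := leqP p n.
  have -> : (p - n.+1 = p - n)%N by rewrite (eqP pn); apply/eqP; rewrite subn_eq0 leqW.
  exact: IHn.
have ltk : (p - n.+1 < p)%N by rewrite ltn_subrL (leq_trans _ np).
have := @tpoly_rec R p d L T (Ordinal ltk) x; rewrite /= => ->.
rewrite rmorph_sum -[RHS](h1 x (Ordinal ltk)); apply: eq_bigr => z _.
by rewrite rmorphM leval_lvar -subSn // IHn mulr1.
Qed.

Lemma marginal_belowS h k x : sums_to_one h ->
  marginal (weight h) (below p k.+1) x
  = h (lab T x k) * marginal (weight h) (below p k) x.
Proof. by move=> h1; rewrite !marginal_below prod_belowS !sum_to_one_tpoly // !mulr1. Qed.

Lemma weight_gt0 a x : (forall l, 0 < a l) -> 0 < weight a x.
Proof. by move=> a0; apply: prodr_gt0 => j _. Qed.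

Lemma stage_csiP st : stage_csi T st -> exists k c,
  [/\ st = Csi [set k] (below p k :\: dom c) set0 c, dom c \subset below p k
    & forall x y, extends c (full_outcome x) -> extends c (full_outcome y) ->
        stage_eq T k x y].
Proof.
case=> k [S [c [SE Sk cS ->]]]; exists k, c.
have [c0 c0k Sc0] := cstree_stages SE Sk.
have [v v_nl Sv] := imsetP SE.
have vS : v \in S by rewrite Sv inE /same_stage v_nl eqxx.
have vk : v \in level d k by apply: (subsetP Sk).
have sub i : i \in dom c0 -> c i = c0 i.
  rewrite inE; case Ei: (c0 i) => [b|//] _; apply/cS => w.
  rewrite Sc0 inE => /andP[_ /forallP/(_ i)]; rewrite inE Ei /=.
  by move/eqP.
have extS y : extends c (full_outcome y) -> floret T v = floret T (prefix y k).
  move=> /extendsP cy; have : prefix y k \in S.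
    rewrite Sc0 inE prefix_level (restrict_extends (extends_fill c0)).
    rewrite extends_restrict2 c0k -extends_restrict -(restrict_extends (extends_fill c0)).
    apply/extendsP=> i ic0; rewrite -sub // cy //.
    by have Ei := sub i ic0; move: ic0; rewrite !inE Ei.
  by rewrite Sv inE => /and3P[_ _ /eqP].
split=> //; last by move=> x y /extS Ex /extS Ey; rewrite /stage_eq -Ex -Ey.
apply/subsetP=> i; rewrite inE; case Ei: (c i) => [b|//] _.
have /cS/(_ v vS) := Ei; move: vk; rewrite inE => /eqP <-.
by rewrite inE => ->.
Qed.

Lemma sum_mix1 (W : nmodType) (F : outcome d -> W) k x y :
  \sum_(z | agree (~: [set k]) y z) F (mix [set k] x z)
  = \sum_(z | agree (~: [set k]) x z) F z.
Proof.
have K u v z : agree (~: [set k]) u z -> mix [set k] u (mix [set k] v z) = z.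
  move=> /agreeP uz; apply/ffunP=> i; rewrite !mixE;
    case: (boolP (i \in [set k])) => // ik.
  by rewrite uz // inE.
have A u z : agree (~: [set k]) u (mix [set k] u z).
  by rewrite agree_sym agree_mixl // disjoints_subset.
rewrite [RHS](reindex_onto (mix [set k] x) (mix [set k] y)) => [|z /K //].
apply: eq_bigl => z; rewrite A; apply/idP/eqP => [/K //|<-].
exact: A.
Qed.

Lemma balanced_ratio k x y : balanced R T -> stage_eq T k x y -> x k = y k ->
  tpoly_at R T k.+1 x * tpoly_at R T k y = tpoly_at R T k.+1 y * tpoly_at R T k x.
Proof.
move=> /balancedP bal xy Exy; rewrite !tpoly_rec -(@sum_mix1 _ _ k x y) !mulr_sumr.
apply: eq_bigr => z yz; set x' := mix _ _ _.
have xz : stage_eq T k x z.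
  apply: stage_eq_trans xy _; apply: agree_stage_eq.
  exact: agree_sub (below_sub_setC1 k) yz.
have -> : lab T z k = lab T x' k.
  apply: stage_eq_lab; last by rewrite mixE inE eqxx.
  rewrite stage_eq_sym; apply: stage_eq_trans xz; apply: agree_stage_eq.
  by rewrite agree_sym agree_below_mix.
rewrite mulrCA bal // -/x' [RHS]mulrCA; congr (_ * _).
rewrite mulrC; congr (_ * _); apply: tpoly_agree.
rewrite belowS agreeU; apply/andP; split.
  rewrite (agree_trans (agree_mixl z x (disjoint_below_set1 k))) // agree_sym.
  exact: agree_sub (below_sub_setC1 k) yz.
rewrite (agree_trans (agree_mixr z x (subxx _))) //.
by apply/agreeP=> i; rewrite inE => /eqP ->.
Qed.

Lemma stage_csi_sound h : (forall l, 0 < h l) -> sums_to_one h ->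
  forall st, stage_csi T st -> wf_csi st /\ csi_holds (weight h) st.
Proof.
move=> h0 h1 st /stage_csiP[k [c [-> ck stc]]]; split.
  apply/wf_csiP=> i; rewrite inE in_setD in_set0.
  case: (boolP (i \in dom c)) => [/(subsetP ck)|_] /=; rewrite [i \in below p k]in_set.
    by have [->|//] := eqVneq i k; rewrite ltnn.
  by have [->|_] := eqVneq i k; rewrite ?ltnn //; case: (_ < _)%N.
move=> x cx /=; rewrite set0U.
have E : below p k :\: dom c :|: dom c = below p k.
  apply/setP=> i; rewrite in_setU in_setD orbC.
  by case: (boolP (i \in dom c)) => [/(subsetP ck)|].
rewrite -setUA E setUC -belowS marginal_belowS // mulrAC; congr (_ * _).
rewrite (@marginal_sum _ _ _ _ ([set k] :|: dom c) (below p k :\: dom c)); last first.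
  apply/disjoint_pointwise=> i; rewrite !inE.
  by have [->|_] := eqVneq i k; rewrite ?ltnn ?andbF //=; case: (c i).
rewrite (@marginal_sum _ _ _ _ (dom c) (below p k :\: dom c)); last first.
  by apply/disjoint_pointwise=> i; rewrite !inE; case: (c i).
rewrite -setUA [dom c :|: _]setUC E mulr_sumr; apply: eq_bigr => z xz.
rewrite setUC -belowS marginal_belowS //; congr (_ * _).
have /stage_eq_lab : stage_eq T k x z.
  apply: stc => //; rewrite (extends_agree _ cx); apply: agree_compl xz.
  by apply/disjoint_pointwise=> i; rewrite !inE; case: (c i).
move=> -> //; apply: (agreeP _ _ _ xz).
by rewrite !inE ltnn andbF.
Qed.

Lemma ker_psi_binomial x y x' y' :
  ker_psi T (pvar R x * pvar R y - pvar R x' * pvar R y') <->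
  forall h, (forall l, 0 < h l) -> sums_to_one h ->
    weight h x * weight h y = weight h x' * weight h y'.
Proof.
rewrite ker_psiP; split=> [H h h0 h1|H h t h0 h1 t0].
  have := H h 1 h0 h1 ltr01; rewrite rmorphB !rmorphM !oeval_pvar /scaled !mul1r.
  by move/eqP; rewrite subr_eq0 => /eqP.
by rewrite rmorphB !rmorphM !oeval_pvar /scaled [X in X - _]mulrACA [X in _ - X]mulrACA
  H // subrr.
Qed.

Lemma J_saturated_ker st f : J T st -> saturated st -> csi_poly st f ->
  ker_psi (R := R) T f.
Proof.
move=> Jst sat [x [y [cx cy xy ->]]]; apply/ker_psi_binomial=> h h0 h1.
have q0 z : 0 < weight h z by apply: weight_gt0.
have [wf H] := derivable_sound q0 (stage_csi_sound h0 h1) Jst.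
exact: (holds_saturated q0 wf sat H).
Qed.

Lemma balanced_rescale a : balanced R T -> (forall l, 0 < a l) ->
  exists h t, [/\ forall l, 0 < h l, sums_to_one h, 0 < t
    & forall x, weight a x = t * weight h x].
Proof.
move=> bal a0; pose M m x := marginal (weight a) (below p m) x.
have M0 m x : 0 < M m x by apply: marginal_gt0 => y; apply: weight_gt0.
have Mn m x : M m x != 0 by rewrite gt_eqF.
pose h (l : label T) : R := let w := cid (labP l) in
  let j := sval (cid (svalP w)) in M j.+1 (sval w) / M j (sval w).
have hE x j : h (lab T x j) = M j.+1 x / M j x.
  rewrite /h; case: cid => y ly /=; case: cid => i /= E.
  have Eij := lab_level E; rewrite -Eij {i Eij} in E *.
  have [xy Exy] := lab_stage_eq E.
  apply/eqP; rewrite eqr_div ?Mn // /M !marginal_below !prod_belowS -E.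
  have := congr1 (leval a) (balanced_ratio bal xy Exy); rewrite !rmorphM /= => Er.
  rewrite -!mulrA; apply/eqP; congr (_ * _).
  by rewrite (mulrCA (leval a (tpoly_at R T j.+1 y))) -Er (mulrCA (leval a (tpoly_at R
    T j.+1 x)))
    [LHS]mulrCA.
have prodM x m : (m <= p)%N ->
    \prod_(j : 'I_p | (j < m)%N) h (lab T x j) = M m x / M 0 x.
  elim: m => [|m IHm] mp; first by rewrite big_pred0 // divff.
  have := prod_belowS (fun j => h (lab T x j)) (Ordinal mp); rewrite /= => ->.
  by rewrite IHm 1?ltnW // hE mulrA divfK.
pose x0 : outcome d := [ffun i => state0 d i]; exists h, (M 0 x0); split=> // [l|x j|x].
- by have [x [j ->]] := labP l; rewrite hE divr_gt0.
- rewrite (eq_bigr (fun z => M j.+1 z / M j x)) => [|z xz]; last first.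
    rewrite hE; congr (_ / _); apply: marginal_agree; rewrite agree_sym.
    exact: agree_sub (below_sub_setC1 j) xz.
  rewrite -mulr_suml /M belowS -marginal_sum ?divff ?Mn //; exact: disjoint_below_set1.
- rewrite (_ : weight h x = M p x / M 0 x); last first.
    by rewrite -prodM //; apply: eq_bigl => j; rewrite ltn_ord.
  have -> : M 0 x0 = M 0 x by apply: marginal_agree; apply/agreeP=> i; rewrite inE.
  by rewrite mulrC divfK // /M belowT // marginalT.
Qed.

Lemma ker_psi_toric f a t : balanced R T -> ker_psi T f ->
  (forall l, 0 < a l) -> 0 < t -> oeval (scaled t a) f = 0.
Proof.
move=> bal /ker_psiP H a0 t0; have [h [u [h0 h1 u0 E]]] := balanced_rescale bal a0.
rewrite -[RHS](H h (t * u) h0 h1 (mulr_gt0 t0 u0)).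
by apply: meval_eq => i; rewrite /scaled E mulrA.
Qed.

End Weights.

(** * Balanced trees split at every stage *)

Section Splitting.
Variables (R : realType) (p : nat) (d : sizes p) (L : finType) (T : cstree d L).
Implicit Types (x y z u v : outcome d) (j k m : 'I_p) (n : nat) (c : poutcome d).
Implicit Types (D : {set 'I_p}).

(* Evaluate at the point where the labels of the floret of [u] are zero and all
   other labels are one. *)
Lemma tpoly_stage_or n u v u' v' :
  tpoly_at R T n u * tpoly_at R T n v = tpoly_at R T n u' * tpoly_at R T n v' ->
  forall k, n = k :> nat -> stage_eq T k u u' || stage_eq T k u v'.
Proof.
move=> E k nk; rewrite {}nk in E; rewrite -[_ || _]negbK negb_or;
  apply/negP=> /andP[uu' uv'].
pose a l : R := if l \in floret_of T u k then 0 else 1.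
have a_u : leval a (tpoly_at R T k u) = 0.
  rewrite tpoly_rec rmorph_sum big1 // => z uz.
  rewrite rmorphM leval_lvar /a ifT ?mul0r //.
  by apply/imsetP; exists z.
have a_other z : ~~ stage_eq T k u z -> 0 < leval a (tpoly_at R T k z).
  move=> uz; have P y : agree (below p k) z y ->
      leval a (\prod_(j : 'I_p | (k <= j)%N) lvar R (lab T y j)) = 1.
    move=> zy; rewrite rmorph_prod big1 // => j kj; rewrite leval_lvar /a ifF //.
    apply: contraNF uz => /imsetP[w /= uw Ew].
    have Ejk := lab_level Ew; rewrite Ejk in Ew; have [yw _] := lab_stage_eq Ew.
    apply: (@stage_eq_trans _ _ _ _ _ _ w).
      by apply: agree_stage_eq; apply: agree_sub (below_sub_setC1 k) uw.
    rewrite stage_eq_sym; apply: stage_eq_trans yw.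
    exact: agree_stage_eq.
  rewrite rmorph_sum (eq_bigr (fun=> 1)) // sumr_const ltr0n.
  by apply/card_gt0P; exists z; apply: agree_refl.
have := congr1 (leval a) E; rewrite !rmorphM /= -![Algebra.Additive.sort _ _]/(leval a _).
rewrite a_u mul0r => /esym/eqP; rewrite mulf_eq0.
by rewrite !gt_eqF ?a_other.
Qed.

Lemma tpoly_stage_pairs k u v u' v' :
  tpoly_at R T k u * tpoly_at R T k v = tpoly_at R T k u' * tpoly_at R T k v' ->
  stage_eq T k u u' && stage_eq T k v v' || stage_eq T k u v' && stage_eq T k v u'.
Proof.
move=> E.
have H1 := tpoly_stage_or E (erefl (val k)).
have H2 := tpoly_stage_or (etrans (mulrC _ _) E) (erefl (val k)).
have H3 := tpoly_stage_or (esym E) (erefl (val k)).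
have H4 := tpoly_stage_or (etrans (mulrC _ _) (esym E)) (erefl (val k)).
move: H1 H2 H3 H4; rewrite /stage_eq.
move: (floret T (prefix u k)) (floret T (prefix v k)) => a b.
move: (floret T (prefix u' k)) (floret T (prefix v' k)) => a' b'.
have [<-{a'}|ne] := eqVneq a a' => /=.
  by have [//|ne] := eqVneq b b' => /= _; rewrite !orbF => /eqP <- _ /eqP Eb;
    rewrite Eb eqxx in ne.
by move=> /eqP<- _ /eqP-> _; rewrite !eqxx.
Qed.

Lemma tpoly_lift k u v u' v' : balanced R T ->
  stage_eq T k u u' -> u k = u' k -> stage_eq T k v v' -> v k = v' k ->
  tpoly_at R T k u * tpoly_at R T k v = tpoly_at R T k u' * tpoly_at R T k v' ->
  tpoly_at R T k.+1 u * tpoly_at R T k.+1 v = tpoly_at R T k.+1 u' * tpoly_at R T k.+1 v'.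
Proof.
move=> bal uu' Eu vv' Ev E.
apply: (mulIf (mulf_neq0 (tpoly_neq0 R T k u') (tpoly_neq0 R T k v'))).
by rewrite mulrACA (balanced_ratio bal uu' Eu) (balanced_ratio bal vv' Ev) mulrACA E.
Qed.

Definition decides D (c : poutcome d) m : Prop :=
  forall x y, extends c (full_outcome x) -> extends c (full_outcome y) ->
    agree (if m \in D then below p m :&: D else below p m :\: D) x y ->
    stage_eq T m x y.

Lemma row_or_column k D c :
  (forall x y, extends c (full_outcome x) -> extends c (full_outcome y) ->
     tpoly_at R T k x * tpoly_at R T k y = tpoly_at R T k (mix D x y) * tpoly_at R T k
       (mix D y x)) ->
  (forall x y, extends c (full_outcome x) -> extends c (full_outcome y) ->
     agree (below p k :&: D) x y -> stage_eq T k x y) \/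
  (forall x y, extends c (full_outcome x) -> extends c (full_outcome y) ->
     agree (below p k :\: D) x y -> stage_eq T k x y).
Proof.
move=> H; have [col|ncol] := pselect (forall x y, extends c (full_outcome x) ->
    extends c (full_outcome y) -> agree (below p k :\: D) x y -> stage_eq T k x y).
  by right.
left; have {ncol} [x0 [y0 [cx0 cy0 xy0 nxy0]]] : exists x0 y0,
    [/\ extends c (full_outcome x0), extends c (full_outcome y0),
        agree (below p k :\: D) x0 y0 & ~~ stage_eq T k x0 y0].
  apply: contra_notP ncol => H0 x y cx cy xy; apply: contrapT => /negP nxy.
  by apply: H0; exists x, y.
have mixD x y z t : agree (below p k :\: D) x y -> agree (below p k :&: D) z t ->
    agree (below p k) (mix D x z) (mix D y t).
  move=> /agreeP xy /agreeP zt; apply/agreeP=> i ik; rewrite !mixE.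
  by case: ifP => iD; [apply: zt|apply: xy]; rewrite ?in_setI ?in_setD iD ik.
have step X Y : extends c (full_outcome X) -> extends c (full_outcome Y) ->
    ~~ stage_eq T k X (mix D X Y) -> stage_eq T k Y (mix D X Y).
  move=> cX cY /negbTE n; have := tpoly_stage_pairs (H X Y cX cY).
  by rewrite n /= => /andP[].
move=> u v cu cv uv.
have key X : extends c (full_outcome X) -> ~~ stage_eq T k X (mix D X u) ->
    stage_eq T k u v.
  move=> cX nX; have := step X u cX cu nX.
  have E : stage_eq T k (mix D X u) (mix D X v).
    by apply: agree_stage_eq; apply: mixD; rewrite ?agree_refl.
  move=> /stage_eq_trans/(_ E) /stage_eq_trans; apply.
  rewrite stage_eq_sym; apply: step => //.
  by apply: contra nX => /stage_eq_trans; apply; rewrite stage_eq_sym.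
have [w1|] := boolP (stage_eq T k x0 (mix D x0 u)); last exact: key.
apply: (key y0) => //; apply: contra nxy0 => w2.
apply: stage_eq_trans w1 _; rewrite stage_eq_sym; apply: stage_eq_trans w2 _.
by apply: agree_stage_eq; apply: mixD; rewrite ?agree_refl // agree_sym.
Qed.

Lemma stage_split_upto k c n : balanced R T -> dom c \subset below p k ->
  (forall x y, extends c (full_outcome x) -> extends c (full_outcome y) ->
     stage_eq T k x y) ->
  (k < n <= p)%N -> exists D,
  [/\ k \in D, (forall i, i \in D -> (k <= i < n)%N),
      (forall m, (m < n)%N -> decides D c m)
    & forall x y, extends c (full_outcome x) -> extends c (full_outcome y) ->
      tpoly_at R T n x * tpoly_at R T n y = tpoly_at R T n (mix D x y) * tpoly_at R T n
        (mix D y x)].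
Proof.
move=> bal ck stc; elim: n => [//|n IHn] /andP[kn np].
have [lt_kn|ge_kn] := ltnP k n; last first.
  have -> : n = k by apply/eqP; rewrite eqn_leq ge_kn -ltnS.
  exists [set k]; split=> [|i|m mk x y cx cy|x y cx cy]; first exact: set11.
  - by rewrite inE => /eqP->; rewrite leqnn ltnSn.
  - rewrite inE; have [->|ne] := eqVneq m k; first by rewrite stc.
    have -> : below p m :\: [set k] = below p m; last exact: agree_stage_eq.
    apply/setDidPl; rewrite disjoint_sym disjoints1 inE -leqNgt.
    by rewrite -ltnS.
  - by apply: (balancedP R T).1 => //; apply: stc.
have [D [kD Dn dec E]] := IHn (introT andP (conj lt_kn (ltnW np))).
pose N := Ordinal np; have NE : n = N by [].
have ND : N \notin D by apply/negP=> /Dn; rewrite ltnn andbF.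
have mix_ext D' x y : extends c (full_outcome x) -> extends c (full_outcome y) ->
  extends c (full_outcome (mix D' x y)) := @extends_mix _ _ c D' x y.
have [row|col] := row_or_column (k := N) E.
  exists (N |: D); split=> [|i|m mn|x y cx cy].
  - by rewrite in_setU kD orbT.
  - rewrite in_setU1 => /orP[/eqP->|/Dn/andP[-> /leqW->//]].
    by rewrite ltnW //= ltnS.
  - have [->|ne] := eqVneq m N.
      move=> x y cx cy; rewrite setU11 => xy; apply: row => //.
      by apply: agree_sub xy; apply: setIS; apply: subsetUr.
    have {}mn : (m < n)%N by rewrite ltn_neqAle -ltnS mn andbT.
    have Nm : N \notin below p m by rewrite inE -leqNgt ltnW.
    have := dec m mn; rewrite /decides in_setU1 (negbTE ne) /=.
    have -> : below p m :&: (N |: D) = below p m :&: D.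
      by apply/setP=> i; rewrite !in_setI in_setU1; have [->|] := eqVneq i N;
        rewrite ?(negbTE Nm).
    have -> // : below p m :\: (N |: D) = below p m :\: D.
      by apply/setP=> i; rewrite !in_setD in_setU1; have [->|] := eqVneq i N;
        rewrite ?(negbTE Nm) ?andbF.
  - set D' := N |: D.
    have st u v : extends c (full_outcome u) -> extends c (full_outcome v) ->
        stage_eq T N v (mix D' u v) /\ v N = mix D' u v N.
      move=> cu cv; split; last by rewrite mixE setU11.
      apply: row => //; first exact: mix_ext.
      rewrite agree_sym; apply: agree_mixr.
      by apply: subset_trans (subsetIr _ _) (subsetUr _ _).
    have [s1 e1] := st x y cx cy; have [s2 e2] := st y x cy cx.
    rewrite mulrC; apply: (tpoly_lift bal s1 e1 s2 e2).
    rewrite mulrC E //; congr (_ * _); apply: tpoly_agree; apply/agreeP=> i iN;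
      by rewrite !mixE in_setU1; case: eqVneq iN => // ->; rewrite inE ltnn.
exists D; split=> [//|i|m mn|x y cx cy].
- by move=> /Dn/andP[-> /leqW->].
- have [->|ne] := eqVneq m N; last by apply: dec; rewrite ltn_neqAle -ltnS mn andbT.
  by move=> x y cx cy; rewrite (negbTE ND); apply: col.
have st u v : extends c (full_outcome u) -> extends c (full_outcome v) ->
    stage_eq T N u (mix D u v) /\ u N = mix D u v N.
  move=> cu cv; split; last by rewrite mixE (negbTE ND).
  apply: col => //; first exact: mix_ext.
  rewrite agree_sym; apply: agree_mixl.
  by rewrite -setI_eq0 setIDAC -setIDA setDv setI0.
have [s1 e1] := st x y cx cy; have [s2 e2] := st y x cy cx.
exact: (tpoly_lift bal s1 e1 s2 e2 (E x y cx cy)).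
Qed.

Lemma stage_split k c : balanced R T -> dom c \subset below p k ->
  (forall x y, extends c (full_outcome x) -> extends c (full_outcome y) ->
     stage_eq T k x y) ->
  exists D, [/\ k \in D, (forall i, i \in D -> (k <= i)%N) & forall m, decides D c m].
Proof.
move=> bal ck stc; have [|D [kD Dk dec _]] := @stage_split_upto k c p bal ck stc.
  by rewrite ltn_ord leqnn.
by exists D; split=> // [i /Dk/andP[]|m]; last exact: dec.
Qed.

Lemma decides_swap D c (A : comPzRingType) (F : label T -> A) x y :
  (forall m, decides D c m) ->
  extends c (full_outcome x) -> extends c (full_outcome y) ->
  (\prod_j F (lab T x j)) * (\prod_j F (lab T y j))
  = (\prod_j F (lab T (mix D x y) j)) * (\prod_j F (lab T (mix D y x) j)).
Proof.
move=> dec cx cy; rewrite -!big_split; apply: eq_bigr => j _ /=.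
have E u v : extends c (full_outcome u) -> extends c (full_outcome v) ->
    lab T (mix D u v) j = lab T (if j \in D then v else u) j.
  move=> cu cv; apply: stage_eq_lab; last by rewrite mixE; case: ifP.
  apply: (dec j); first exact: extends_mix.
    by case: ifP.
  case: ifP => jD; first by apply: agree_mixr; apply: subsetIr.
  by apply: agree_mixl; rewrite -setI_eq0 setIDAC -setIDA setDv setI0.
by rewrite !E //; case: ifP; rewrite // mulrC.
Qed.

End Splitting.

Section Derivation.
Variables (p : nat) (d : sizes p) (L : finType) (T : cstree d L).
Implicit Types (x y z : outcome d) (j k m : 'I_p) (n : nat) (c : poutcome d).
Implicit Types (A B D S U : {set 'I_p}).

Lemma stage_eq_derivable m B U c : [disjoint U & B] -> [disjoint U & dom c] ->
  [disjoint B & dom c] -> U :|: B :|: dom c = below p m ->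
  (forall x y, extends c (full_outcome x) -> extends c (full_outcome y) ->
     agree U x y -> stage_eq T m x y) ->
  J T (Csi [set m] B U c).
Proof.
move=> UB Uc Bc Em st; rewrite -[U]set0U; apply: der_absorption => // y Ey.
have dyc : [disjoint dom y & dom c] by rewrite Ey.
pose x := fill (join y c); have yx : extends (join y c) (full_outcome x)
  by exact: extends_fill.
have yc z : extends (join y c) (full_outcome z) -> stage_eq T m x z.
  move=> yz; move: (yx) (yz); rewrite !extends_join // => /andP[yx' cx] /andP[yz' cz].
  by apply: st; rewrite // -Ey -(extends_agree _ yx').
have [c' [c'm c'P c'st]] := stage_context T m x.
have c'x : extends c' (full_outcome x) by rewrite -c'P stage_eq_refl.
have dc' : dom c' \subset U :|: dom c.
  apply/subsetP=> i ic'; rewrite -Ey -dom_join; apply: contraT => ni.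
  have : extends (join y c) (full_outcome (mix [set i] x (toggle x))).
    by rewrite (extends_agree _ yx) agree_sym agree_mixl // disjoint_sym disjoints1.
  move/yc; rewrite c'P (extends_agree _ c'x) => /agreeP/(_ i ic').
  by rewrite mixE set11 => /esym/toggleP.
pose E := (U :|: dom c) :\: dom c'.
have BE : below p m :\: dom c' = B :|: E.
  apply/setP=> i; rewrite -Em /E !(in_setD, in_setU).
  have /implyP := subsetP dc' i; rewrite in_setU.
  move/disjoint_pointwise/(_ i): Bc; move/disjoint_pointwise/(_ i): UB.
  by do ![case: (i \in _)].
have dBE : [disjoint B & E].
  apply/disjoint_pointwise=> i; rewrite /E !(in_setD, in_setU).
  move/disjoint_pointwise/(_ i): Bc; move/disjoint_pointwise/(_ i): UB.
  by do ![case: (i \in _)].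
have := der_axiom c'st; rewrite BE => /(der_weak_union dBE); rewrite set0U => J1.
have := @der_specialization _ _ _ _ _ _ _ (restrict E x) _ J1.
rewrite dom_restrict setDv => /(_ (subxx _)).
have dE : [disjoint E & dom c'] by rewrite /E -setI_eq0 setIDAC -setIDA setDv setI0.
have ex : extends (join (restrict E x) c') (full_outcome x)
  by apply: extends_join_restrict.
rewrite (restrict_extends ex) (restrict_extends yx) !dom_join dom_restrict Ey.
rewrite (_ : E :|: dom c' = U :|: dom c) //.
apply/setP=> i; rewrite /E in_setU in_setD; have := subsetP dc' i.
by case: (i \in dom c') => [-> //|_] /=; rewrite orbF.
Qed.

Lemma split_derivable k D c : dom c \subset below p k -> k \in D ->
  (forall i, i \in D -> (k <= i)%N) -> (forall m, decides T D c m) ->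
  J T (Csi D (~: D :\: dom c) set0 c).
Proof.
move=> ck kD Dk dec.
have dDc : [disjoint D & dom c].
  apply/disjoint_pointwise=> i; apply/negP=> /andP[/Dk ki /(subsetP ck)].
  by rewrite inE ltnNge ki.
have dDcn n : [disjoint below p n :&: D & dom c] by apply: disjointWl (subsetIr _ _) dDc.
have dBcn n : [disjoint below p n :\: D :\: dom c & dom c].
  by rewrite -setI_eq0 setIDAC -setIDA setDv setI0.
have dDBn n : [disjoint below p n :&: D & below p n :\: D :\: dom c].
  by apply/disjoint_pointwise=> i; rewrite !in_setD in_setI; case: (i \in D);
    rewrite ?andbF.
have En n : (k < n)%N -> below p n :&: D :|: (below p n :\: D :\: dom c) :|: dom c =
  below p n.
  move=> kn; apply/setP=> i; rewrite !in_setU !in_setD in_setI.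
  have := subsetP ck i; rewrite !in_set;
    case: (boolP (c i != None)) => /= [_ /(_ isT) ik|_ _].
    by rewrite orbT (ltn_trans ik).
  by rewrite orbF; case: (i \in D); rewrite /= ?andbF ?andbT ?orbF.
have {}dec m x y : extends c (full_outcome x) -> extends c (full_outcome y) ->
    agree (if m \in D then below p m :&: D else below p m :\: D :\: dom c) x y ->
    stage_eq T m x y.
  move=> cx cy xy; apply: (dec m) => //; case: ifP xy => // _ /agreeP xy.
  apply/agreeP=> i iD; have [ic|ic] := boolP (i \in dom c); last by apply: xy;
    rewrite in_setD ic.
  by have := cy; rewrite (extends_agree _ cx) => /agreeP; apply.
have K n : (k < n <= p)%N ->
    J T (Csi (below p n :&: D) (below p n :\: D :\: dom c) set0 c).
  elim: n => [//|n IHn] /andP[kn np].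
  have [lt_kn|ge_kn] := ltnP k n; last first.
    have -> : n = k by apply/eqP; rewrite eqn_leq ge_kn -ltnS.
    have E1 : below p k.+1 :&: D = [set k].
      apply/setP=> i; rewrite in_setI in_set1 inE ltnS;
        apply/andP/eqP => [[ik /Dk ki]|->].
        by apply/val_inj/eqP; rewrite eqn_leq ik.
      by rewrite leqnn.
    have E2 : below p k.+1 :\: D :\: dom c = below p k :\: dom c.
      apply/setP=> i; rewrite !in_setD belowS in_setU in_set1.
      have [->|_] := eqVneq i k; first
        by rewrite kD /= andbF [k \in below p k]in_set ltnn andbF.
      rewrite orbF; have [/Dk ki|//] := boolP (i \in D).
      by rewrite [i \in below p k]in_set ltnNge ki.
    rewrite E1 E2; apply: stage_eq_derivable.
    - by rewrite -setI_eq0 set0I.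
    - by rewrite -setI_eq0 set0I.
    - by rewrite -setI_eq0 setIDAC -setIDA setDv setI0.
    - apply/setP=> i; rewrite !in_setU in_setD in_set0 /=.
      by have [/(subsetP ck) ->|_] := boolP (i \in dom c); rewrite ?orbT ?orbF.
    - move=> x y cx cy _; apply: dec => //; rewrite kD.
      apply/agreeP=> i; rewrite in_setI inE => /andP[ik /Dk].
      by rewrite leqNgt ik.
  have IH := IHn (introT andP (conj lt_kn (ltnW np))).
  pose N := Ordinal np; have NE : n = N by [].
  have [ND|ND] := boolP (N \in D).
    have -> : below p n.+1 :&: D = [set N] :|: below p n :&: D.
      rewrite NE belowS setIUl setUC; congr (_ :|: _).
      by apply/setIidPl; rewrite sub1set.
    have -> : below p n.+1 :\: D :\: dom c = below p n :\: D :\: dom c.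
      rewrite NE belowS setDUl (_ : [set N] :\: D = set0) ?setU0 //.
      by apply/eqP; rewrite setD_eq0 sub1set.
    apply/der_symmetry/der_contraction; first by rewrite -setI_eq0 set0I.
      rewrite set0U; apply: der_symmetry; apply: stage_eq_derivable => //.
      - exact: En.
      - by move=> x y cx cy xy; apply: dec; rewrite // ND.
    exact: der_symmetry.
  have -> : below p n.+1 :&: D = below p n :&: D.
    rewrite NE belowS setIUl (_ : [set N] :&: D = set0) ?setU0 //.
    by apply/eqP; rewrite setI_eq0 disjoints1.
  have -> : below p n.+1 :\: D :\: dom c = [set N] :|: below p n :\: D :\: dom c.
    rewrite NE belowS setDUl setDUl setUC; congr (_ :|: _).
    rewrite (_ : [set N] :\: D = [set N]); last by apply/setDidPl; rewrite disjoints1.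
    apply/setDidPl; rewrite disjoints1; apply/negP=> /(subsetP ck).
    by rewrite inE ltnNge ltnW.
  apply: der_contraction; first by rewrite -setI_eq0 set0I.
    rewrite set0U; apply: der_symmetry; apply: stage_eq_derivable => //.
    - by rewrite disjoint_sym.
    - by rewrite [_ :|: (below p n :&: D)]setUC; apply: En.
    - by move=> x y cx cy xy; apply: dec; rewrite // (negbTE ND).
  exact: IH.
have := K p; rewrite ltn_ord leqnn => /(_ isT).
rewrite belowT // setTI -setTD //.
Qed.

End Derivation.

Section Closure.
Variables (p : nat) (d : sizes p).
Implicit Types (x y z : outcome d) (c : poutcome d) (A B S U : {set 'I_p}).

Lemma closure_axiom (P : csi d -> Prop) st : (forall st', P st' -> wf_csi st') ->
  spec_abs_closure P st -> wf_csi st /\ forall x, extends (ctx st) (full_outcome x) ->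
  exists S c, [/\ P (Csi (lhs st) (rhs st) S c), extends c (full_outcome x)
    & S :|: dom c = cond st :|: dom (ctx st)].
Proof.
move=> Pwf; elim=> {st}.
- case=> A B S c Pst; split=> [|x cx]; first exact: Pwf.
  by exists S, c.
- move=> A B S c x xS _ [wf H]; have [xc E wf'] := wf_specialization xS wf.
  by split=> // z; rewrite extends_join // => /andP[_ /H]; rewrite /= E.
- move=> A B S c U Uc _ IH; split; first by apply: wf_absorption => // x /IH[].
  move=> z cz; have [_ H] := IH _ (dom_restrict U z).
  have := H z (extends_join_restrict Uc cz).
  by rewrite /= dom_join dom_restrict setUA.
Qed.

End Closure.

(** * d-separation after directed moralization *)

Section Separation.
Variables (p : nat) (d : sizes p).
Implicit Types (G H : rel 'I_p) (A B S D : {set 'I_p}) (c : poutcome d).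

Lemma active_sub G H S s a : subrel G H -> (forall u v, H u v -> (u < v)%N) ->
  path (adjacent G) a s -> active G S (a :: s) -> active H S (a :: s).
Proof.
move=> GH ltH; elim: s a => [//|m s IHs] a /= /andP[am ms] /andP[op act].
apply/andP; split; last exact: IHs.
case: s op ms {IHs act} => [//|w s] op /= /andP[mw _]; move: op; rewrite /open_at.
case: ifP => [/andP[Gam Gwm] /exists_inP[z zS mz]|ncol mS].
  rewrite !GH //=; apply/exists_inP; exists z => //.
  by apply: connect_sub mz => u v /GH; apply: connect1.
rewrite ifF //; apply/negbTE; apply/negP=> /andP[Ham Hwm].
move: ncol; have -> : G a m.
  by case/orP: am => // /GH/ltH; rewrite ltnNge ltnW // ltH.
by case/orP: mw => [/GH/ltH|-> //]; rewrite ltnNge ltnW // ltH.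
Qed.

Lemma dsep_sub G H A B S : subrel G H -> (forall u v, H u v -> (u < v)%N) ->
  dsep H A B S -> dsep G A B S.
Proof.
move=> GH ltH sepH a s Gs us aA lB; apply: contra (sepH a s _ us aA lB).
  exact: active_sub.
by apply: sub_path Gs => u v /orP[/GH uv|/GH vu]; rewrite /adjacent ?uv ?vu ?orbT.
Qed.

Lemma dsep_nonadjacent G A B S a b : dsep G A B S -> a \in A -> b \in B ->
  a != b -> ~~ adjacent G a b.
Proof.
move=> sep aA bB ab; apply/negP=> Gab.
by have := sep a [:: b]; rewrite /= Gab inE ab andbT => /(_ isT isT aA bB).
Qed.

Lemma dsep_of_nonadjacent G D B S : [disjoint D & B] ->
  (forall u v, G u v -> (u < v)%N) ->
  (forall u v, adjacent G u v -> v \in D :|: B :|: S) ->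
  (forall i s, i \in D -> s \in S -> (s < i)%N) ->
  (forall a b, a \in D -> b \in B -> ~~ adjacent G a b) ->
  dsep G D B S.
Proof.
move=> DB ltG V SD nDB a s; elim: s a => [a _ _ aD /=|m s IHs a /= /andP[am ms]].
  by rewrite (disjointFr DB aD).
move=> /andP[_ us] aD lB; have mV := V _ _ am.
have mB : m \notin B by apply: contraL am; apply: nDB.
have [mD|mD] := boolP (m \in D); first by rewrite negb_and IHs ?orbT.
have mS : m \in S by move: mV; rewrite !in_setU (negbTE mD) (negbTE mB).
case: s {IHs} ms lB us => [_ /= lB|w s _ _ _]; first by rewrite lB in mB.
rewrite /open_at ifF ?mS //; apply/negbTE; rewrite negb_and; apply/orP; left.
by apply/negP=> /ltG; rewrite ltnNge ltnW // SD.
Qed.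

Lemma dm_sub G : subrel G (dm G).
Proof. by move=> u v; rewrite /dm => ->. Qed.

Lemma iter_dm_sub G n : subrel G (iter n (@dm p) G).
Proof. by elim: n => [|n IHn] u v //= /IHn /dm_sub. Qed.

Lemma dm_context_dag c G : context_dag c G -> context_dag c (dm G).
Proof.
move=> dag u v /orP[/dag //|/andP[uv /existsP[w /andP[/dag[uc _ _] /dag[vc _ _]]]]].
by [].
Qed.

Lemma per_context_dag c G : context_dag c G -> context_dag c (per G).
Proof. by move=> dag; rewrite /per; elim: 'C(p, 2) => [//|n] /dm_context_dag. Qed.

(* No element of [D] precedes an element of [S], so a common child of [D] and [B]
   lies in [D] or in [B] and is already adjacent to the other part. *)
Lemma per_nonadjacent c G D B S : context_dag c G ->
  D :|: B :|: S :|: dom c = setT ->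
  (forall i s, i \in D -> s \in S -> (s < i)%N) ->
  (forall a b, a \in D -> b \in B -> ~~ adjacent G a b) ->
  forall a b, a \in D -> b \in B -> ~~ adjacent (per G) a b.
Proof.
move=> dag V SD nDB; rewrite /per; elim: 'C(p, 2) => [//|n IHn] /=.
have {dag nDB} : context_dag c (iter n (@dm p) G).
  by elim: n {IHn} => [//|n] /dm_context_dag.
move: (iter n _ G) IHn => K nDB dag a b aD bB.
have nch w : K a w -> K b w -> False.
  move=> aw bw; have [_ wc lt_aw] := dag _ _ aw.
  have : w \in D :|: B :|: S :|: dom c by rewrite V inE.
  rewrite !in_setU (negbTE wc) orbF => /orP[/orP[wD|wB]|wS].
  - by have := nDB w b wD bB; rewrite /adjacent bw orbT.
  - by have := nDB a w aD wB; rewrite /adjacent aw.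
  - by have := SD a w aD wS; rewrite ltnNge ltnW.
have := nDB a b aD bB; rewrite /adjacent /dm !negb_or => /andP[/negbTE-> /negbTE->] /=.
rewrite !negb_and; apply/andP; split; apply/orP; right;
  by apply/existsPn=> w; apply/negP=> /andP[H1 H2]; apply: (nch w).
Qed.

End Separation.

Definition ideal_like (A : comNzRingType) (I : A -> Prop) : Prop :=
  I 0 /\ forall b f g, I f -> I g -> I (b * f + g).

(** * Connecting monomials of the toric ideal *)

Section Connectivity.
Variables (R : realType) (p : nat) (d : sizes p) (L : finType) (T : cstree d L).
Local Notation RD := {mpoly R[#|{: outcome d}|]}.
Implicit Types (x y z : outcome d) (k j : 'I_p) (D : {set 'I_p}) (xs ys : seq (outcome
  d)).

Definition path_monomial x : {mpoly R[#|{: label T}|]} := \prod_j lvar R (lab T x j).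

Lemma leval_path_monomial a x : leval a (path_monomial x) = weight a x.
Proof. by rewrite rmorph_prod; apply: eq_bigr => j _; rewrite leval_lvar. Qed.

Lemma path_monomial_neq0 x : path_monomial x != 0.
Proof.
have : weight (fun _ : label T => 1 : R) x != 0 by rewrite gt_eqF // weight_gt0.
by apply: contraNneq => E; rewrite -leval_path_monomial E rmorph0.
Qed.

Variable I : RD -> Prop.
Hypothesis I_ideal : ideal_like I.
Hypothesis I_swap : forall k x y, stage_eq T k x y -> ~~ agree (below p k) x y ->
  exists D, [/\ k \in D, forall i, i \in D -> (k <= i)%N,
    I (pvar R x * pvar R y - pvar R (mix D x y) * pvar R (mix D y x))
    & path_monomial x * path_monomial y
      = path_monomial (mix D x y) * path_monomial (mix D y x)].

Lemma ideal_sub_trans f g h : I (f - g) -> I (g - h) -> I (f - h).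
Proof.
move=> fg gh; rewrite (_ : f - h = 1 * (f - g) + (g - h));
  last by rewrite mul1r addrA subrK.
exact: I_ideal.2.
Qed.

Lemma ideal_mul b f : I f -> I (b * f).
Proof. by move=> If; rewrite -[b * f]addr0; apply: I_ideal.2 If I_ideal.1. Qed.

(* Evaluate the label of the edge of [x] at zero and the other labels at one. *)
Lemma path_monomial_dvd x ys (f : {mpoly R[#|{: label T}|]}) k :
  path_monomial x * f = \prod_(y <- ys) path_monomial y ->
  exists2 y, y \in ys & stage_eq T k y x /\ y k = x k.
Proof.
move=> E; pose a l : R := if l == lab T x k then 0 else 1.
have ax : leval a (path_monomial x) = 0.
  by rewrite leval_path_monomial /weight (bigD1 k) //= /a eqxx mul0r.
have := congr1 (leval a) E; rewrite rmorphM ax mul0r rmorph_prod => /esym/eqP.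
rewrite prodf_seq_eq0 => /hasP[y yys /=]; rewrite leval_path_monomial => y0.
exists y => //; have /prodf_eq0[j _] := y0; rewrite /a.
case: (eqVneq (lab T y j) (lab T x k)) => [Ej _|ne E1]; last first.
  by move: E1; rewrite oner_eq0.
have Ejk := lab_level Ej; rewrite Ejk in Ej; exact: lab_stage_eq Ej.
Qed.

Lemma align x xs ys (m : nat) : (m <= p)%N -> size ys = (size xs).+1 ->
  path_monomial x * \prod_(y <- xs) path_monomial y = \prod_(y <- ys) path_monomial y ->
  exists y1 ys', [/\ size ys' = size xs,
    \prod_(y <- y1 :: ys') path_monomial y = \prod_(y <- ys) path_monomial y,
    I (\prod_(y <- ys) pvar R y - \prod_(y <- y1 :: ys') pvar R y)
    & agree (below p m) y1 x].
Proof.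
move=> mp sz E; elim: m mp => [_|m IHm mp].
  case: ys sz E => [//|y ys [sz] _]; exists y, ys; split=> //.
    by rewrite subrr; apply: I_ideal.1.
  by apply/agreeP=> i; rewrite inE.
have [y1 [ys' [sz' E' I' y1x]]] := IHm (ltnW mp); pose k := Ordinal mp.
have agreeS y : agree (below p m) y x -> y k = x k -> agree (below p m.+1) y x.
  move=> yx Ek; rewrite (belowS k) agreeU yx /=.
  by apply/agreeP=> i; rewrite inE => /eqP ->.
have [y yys [yx Ek]] := path_monomial_dvd k (etrans E (esym E')).
move: yys; rewrite in_cons => /orP[/eqP Ey|yys].
  by exists y1, ys'; split=> //; apply: agreeS; rewrite // -Ey.
have perm : perm_eq ys' (y :: rem y ys') by apply: perm_to_rem.
have szr : size (y1 :: rem y ys') = size xs by rewrite -sz' (perm_size perm).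
have [y1y|y1y] := boolP (agree (below p k) y1 y).
  have perm2 : perm_eq (y1 :: ys') (y :: y1 :: rem y ys').
    apply: (@perm_trans _ (y1 :: y :: rem y ys')); first by rewrite perm_cons.
    by apply/permEl/(perm_catCA [:: y1] [:: y]).
  exists y, (y1 :: rem y ys'); split=> //.
  - by rewrite -E'; apply/perm_big; rewrite perm_sym.
  - by rewrite -(perm_big _ perm2).
  - by apply: agreeS Ek; apply: agree_trans y1x; rewrite agree_sym.
have st : stage_eq T k y1 y.
  apply: (@stage_eq_trans _ _ _ _ _ _ x); last by rewrite stage_eq_sym.
  exact: agree_stage_eq.
have [D [kD Dk ID pD]] := I_swap st y1y.
have split2 (A : comPzRingType) (F : outcome d -> A) :
    \prod_(z <- y1 :: ys') F z = (F y1 * F y) * \prod_(z <- rem y ys') F z.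
  by rewrite big_cons (perm_big _ perm) big_cons mulrA.
exists (mix D y1 y), (mix D y y1 :: rem y ys'); split=> //.
- by rewrite -E' split2 pD !big_cons mulrA.
- apply: ideal_sub_trans I' _; rewrite split2 !big_cons mulrA -mulrBl mulrC.
  exact: ideal_mul.
- apply: agreeS; last by rewrite mixE kD.
  apply: agree_trans y1x; apply: agree_mixl; apply/disjoint_pointwise=> i.
  by apply/negP=> /andP[+ /Dk]; rewrite inE ltnNge => /negbTE ->.
Qed.

Lemma connect_monomials xs ys : size xs = size ys ->
  \prod_(x <- xs) path_monomial x = \prod_(y <- ys) path_monomial y ->
  I (\prod_(x <- xs) pvar R x - \prod_(y <- ys) pvar R y).
Proof.
elim: xs ys => [|x xs IHxs] ys sz E.
  by case: ys sz {E} => // _; rewrite subrr; apply: I_ideal.1.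
have [|y1 [ys' [sz' E' I' y1x]]] := @align x xs ys p (leqnn p) (esym sz).
  by rewrite -E big_cons.
have Ey : y1 = x by apply/eqP; rewrite -agree_setT -(belowT (leqnn p)).
rewrite {}Ey in E' I'; rewrite -opprB -mulN1r; apply: ideal_mul.
apply: ideal_sub_trans I' _; rewrite !big_cons -mulrBr; apply: ideal_mul.
rewrite -opprB -mulN1r; apply: ideal_mul; apply: IHxs; first by rewrite sz'.
by move: E; rewrite -E' !big_cons => /(mulfI (path_monomial_neq0 x)).
Qed.

Definition label_count x (l : label T) : nat := \sum_j (lab T x j == l).

Lemma prod_lab (A : comPzRingType) (F : label T -> A) x :
  \prod_j F (lab T x j) = \prod_l F l ^+ label_count x l.
Proof.
rewrite (eq_bigr (fun j => \prod_l F l ^+ (lab T x j == l))) => [|j _].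
  by rewrite exchange_big; apply: eq_bigr => l _; rewrite -expr_sum.
rewrite (bigD1 (lab T x j)) //= eqxx expr1 big1 ?mulr1 // => l.
by rewrite eq_sym => /negbTE ->.
Qed.

Definition monomial_outcomes (m : 'X_{1..#|{: outcome d}|}) : seq (outcome d) :=
  flatten [seq nseq (m i) (enum_val i) | i <- enum 'I_#|{: outcome d}|].

Lemma prod_monomial_outcomes (A : comPzRingType) (F : outcome d -> A) m :
  \prod_(x <- monomial_outcomes m) F x = \prod_i F (enum_val i) ^+ m i.
Proof.
rewrite big_flatten big_map big_enum; apply: eq_bigr => i _ /=.
by rewrite big_nseq; elim: (m i) => [|n IHn]; rewrite ?expr0 // iterS IHn exprS.
Qed.

Lemma size_monomial_outcomes m : size (monomial_outcomes m) = mdeg m.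
Proof.
rewrite size_flatten /shape sumnE !big_map -enumT big_enum mdegE.
by apply: eq_bigr => i _; rewrite size_nseq.
Qed.

Lemma monomial_pvar m : 'X_[m] = \prod_(x <- monomial_outcomes m) pvar R x :> RD.
Proof.
rewrite prod_monomial_outcomes mpolyXE_id; apply: eq_bigr => i _.
by rewrite /pvar enum_valK.
Qed.

(* [inl tt] stands for the homogenizing variable. *)
Definition toric_exponent (m : 'X_{1..#|{: outcome d}|}) (o : unit + label T) : nat :=
  if o is inr l then \sum_i label_count (enum_val i) l * m i else mdeg m.

Lemma toric_monomial (A : comPzRingType) (F : label T -> A) m :
  \prod_(x <- monomial_outcomes m) \prod_j F (lab T x j)
  = \prod_l F l ^+ toric_exponent m (inr l).
Proof.
rewrite prod_monomial_outcomes.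
rewrite (eq_bigr (fun i => \prod_l F l ^+ (label_count (enum_val i) l * m i))) => [|i _].
  by rewrite exchange_big; apply: eq_bigr => l _; rewrite -expr_sum.
by rewrite prod_lab -prodrXl; apply: eq_bigr => l _; rewrite exprM.
Qed.

Lemma oeval_toric (h : unit + label T -> R) m :
  oeval (scaled (h (inl tt)) (fun l =>
    h (inr l))) 'X_[m] = \prod_o h o ^+ toric_exponent m o.
Proof.
rewrite monomial_pvar rmorph_prod.
rewrite (eq_bigr (fun x => h (inl tt) * weight (fun l => h (inr l)) x)) => [|x _];
  last first.
  by rewrite oeval_pvar.
rewrite big_split /= big_const_seq count_predT size_monomial_outcomes toric_monomial.
rewrite big_sumType /= (big_pred1 tt) => [|[]//]; congr (_ * _).
by elim: (mdeg m) => [|n IHn]; rewrite ?expr0 // iterS IHn exprS.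
Qed.

Lemma toric_exponent_binomial m m' : toric_exponent m =1 toric_exponent m' ->
  I ('X_[m] - 'X_[m']).
Proof.
move=> E; rewrite !monomial_pvar; apply: connect_monomials.
  by rewrite !size_monomial_outcomes; apply: (E (inl tt)).
by rewrite !toric_monomial; apply: eq_bigr => l _; rewrite E.
Qed.

Lemma toric_ideal_sub (f : RD) :
  (forall (a : label T -> R) (t : R), (forall l, 0 < a l) -> 0 < t ->
     oeval (scaled t a) f = 0) -> I f.
Proof.
have [n] := ubnP (size (msupp f)); elim: n f => [//|n IHn] f; rewrite ltnS => sz H.
have [->|f0] := eqVneq f 0; first exact: I_ideal.1.
have [m mf] : exists m, m \in msupp f by exists (mlead f); apply: mlead_supp.
have sum0 : \sum_(m' <- msupp f | [forall o, toric_exponent m' o == toric_exponent m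
  o]) f@_m' = 0.
  apply: (sum_monomials_eq0 (ltr01 : 0 < (1 : R))) => h h0.
  transitivity (oeval (scaled (h (inl tt)) (fun l => h (inr l))) f); last first.
    by apply: H => [l|]; [case/andP: (h0 (inr l))|case/andP: (h0 (inl tt))].
  rewrite [in RHS](mpolyE f) rmorph_sum; apply: eq_bigr => m' _.
  by rewrite -mul_mpolyC rmorphM oeval_toric /= mevalC.
have [m' [m'f ne E]] : exists m',
    [/\ m' \in msupp f, m' != m & toric_exponent m =1 toric_exponent m'].
  apply: contrapT => noE; move: (mf); apply/negP; rewrite -mcoeff_eq0; apply/eqP.
  move: sum0; rewrite big_mkcond (bigD1_seq m) ?msupp_uniq //=.
  case: ifP => [_|/negbT/forallPn[o]]; last by rewrite eqxx.
  rewrite big1_seq ?addr0 // => m' /andP[ne m'f]; case: ifP => [/forallP E|//].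
  by case: noE; exists m'; split=> // o; apply/esym/eqP.
have E0 (a : label T -> R) (t : R) : (forall l, 0 < a l) -> 0 < t ->
    oeval (scaled t a) ('X_[m] - 'X_[m'] : RD) = 0.
  move=> a0 t0; pose h (o : unit + label T) := if o is inr l then a l else t.
  rewrite rmorphB !(oeval_toric h); apply/eqP; rewrite subr_eq0; apply/eqP.
  by apply: eq_bigr => o _; rewrite E.
pose g := f - (f@_m)%:MP * ('X_[m] - 'X_[m']).
have -> : f = (f@_m)%:MP * ('X_[m] - 'X_[m']) + g by rewrite addrC subrK.
apply: I_ideal.2; first exact: toric_exponent_binomial.
apply: IHn => [|a t a0 t0]; last by rewrite rmorphB rmorphM H // E0 // mulr0 subr0.
apply: leq_trans sz; apply: (@leq_ltn_trans (size (rem m (msupp f)))); last first.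
  by rewrite size_rem // prednK // -has_predT; apply/hasP; exists m.
apply: uniq_leq_size => [|m2]; first exact: msupp_uniq.
rewrite mem_rem_uniq ?msupp_uniq // inE !mcoeff_msupp mcoeffB mcoeffCM mcoeffB !mcoeffX.
have [->|m2m] /= := eqVneq m2 m.
  by rewrite (negbTE ne) subr0 mulr1 subrr eqxx.
rewrite sub0r; have [<- _|_] := eqVneq m' m2; first by rewrite -mcoeff_msupp.
by rewrite oppr0 mulr0 subr0.
Qed.

End Connectivity.

Section Ideals.
Variables (R : realType) (p : nat) (d : sizes p).
Local Notation RD := {mpoly R[#|{: outcome d}|]}.
Implicit Types (c : poutcome d) (G : poutcome d -> rel 'I_p) (Cs : {set poutcome d}).

Lemma ideal_gen_incl (A : comNzRingType) (P : A -> Prop) f : P f -> ideal_gen P f.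
Proof.
move=> Pf; exists 1%N, (fun=> 1), (fun=> f); split=> //.
by rewrite big_ord1 mul1r.
Qed.

Lemma ideal_gen_sub (A : comNzRingType) (P I : A -> Prop) : ideal_like I ->
  (forall f, P f -> I f) -> forall f, ideal_gen P f -> I f.
Proof.
move=> [I0 IMD] PI f [n [a [g [Pg ->]]]]; elim/big_rec: _ => // i f' _ If'.
by apply: IMD => //; apply: PI.
Qed.

Lemma ideal_sum_ideal Cs G :
  ideal_like (ideal_sum Cs (fun c => @I_Sat R p d c (G c))).
Proof.
split=> [|b f f' [g Ig ->] [g' Ig' ->]].
  by exists (fun=> 0); [move=> c _; apply: ideal_gen0|rewrite big1].
exists (fun c => b * g c + g' c) => [c cC|].
  by apply: ideal_genMD; [apply: Ig|apply: Ig'].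
by rewrite big_split mulr_sumr.
Qed.

Lemma ideal_sum_incl Cs G c st f : c \in Cs -> Sat c (G c) st -> csi_poly st f ->
  ideal_sum Cs (fun c => @I_Sat R p d c (G c)) f.
Proof.
move=> cC Sst stf; exists (fun c' => if c' == c then f else 0) => [c' _|].
  case: eqP => [->|_]; last exact: ideal_gen0.
  by apply: ideal_gen_incl; exists st.
by rewrite -big_mkcondr (big_pred1 c) // => c' /=; case: eqP => [->|]; rewrite ?cC ?andbF.
Qed.

Lemma ideal_sum_sub Cs G (I : RD -> Prop) : ideal_like I ->
  (forall c st f, c \in Cs -> Sat c (G c) st -> csi_poly st f -> I f) ->
  forall f, ideal_sum Cs (fun c => @I_Sat R p d c (G c)) f -> I f.
Proof.
move=> II H f [g Ig ->]; elim/big_ind: _ => [|u v Iu Iv|c cC].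
- exact: II.1.
- by rewrite -[u]mul1r; apply: II.2.
- by apply: ideal_gen_sub (Ig c cC) => // u [st Sst stu]; exact: (H c st).
Qed.

End Ideals.

Section Toric.
Variables (R : realType) (p : nat) (d : sizes p) (L : finType) (T : cstree d L).
Local Notation RD := {mpoly R[#|{: outcome d}|]}.
Implicit Types (x y z : outcome d) (k j : 'I_p) (D : {set 'I_p}) (c : poutcome d).
Implicit Types (h : label T -> R).

Lemma ker_psi_ideal : ideal_like (fun f : RD => ker_psi T f).
Proof.
split=> [|b f g /ker_psiP fH /ker_psiP gH]; apply/ker_psiP=> h t h0 h1 t0.
  exact: rmorph0.
by rewrite rmorphD rmorphM fH // gH // mulr0 addr0.
Qed.

Lemma eval_ideal (A : comNzRingType) (e : {rmorphism RD -> A}) :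
  ideal_like (fun f : RD => e f = 0).
Proof. by split=> [|b f g]; rewrite ?rmorph0 // rmorphD rmorphM => -> ->;
  rewrite mulr0 addr0. Qed.

Lemma monomial_order (c c' : R) (e e' b b' : nat) : 0 < c -> 0 < c' ->
  (forall t, 0 < t < 1 -> c * t ^+ e * (1 - t) ^+ b = c' * t ^+ e' * (1 - t) ^+ b') ->
  (e' <= e)%N.
Proof.
move=> c0 c'0 H; rewrite leqNgt; apply/negP=> lt_e.
(* Otherwise divide by [t ^+ e] and let [t] tend to zero. *)
pose P : {poly R} := c *: (1 - 'X) ^+ b - c' *: ('X^(e' - e) * (1 - 'X) ^+ b').
have P0 : P = 0.
  apply: (poly_eq0_itv ltr01) => t /andP[t0 t1]; rewrite !hornerE /=.
  apply: (mulfI (lt0r_neq0 (exprn_gt0 e t0))); rewrite mulr0 mulrBr.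
  have := H t; rewrite t0 t1 => /(_ isT) Ht.
  rewrite mulrA [_ * c]mulrC Ht -{1}(subnKC (ltnW lt_e)) exprD.
  by rewrite -!mulrA [X in _ - X]mulrCA subrr.
have := congr1 (fun Q : {poly R} => Q.[0]) P0; rewrite !hornerE /=.
rewrite expr0n subn_eq0 leqNgt lt_e /= mulr0 mul0r !subr0 expr1n mulr1.
by move/eqP; rewrite gt_eqF.
Qed.

Lemma label_count_eq x y x' y' :
  (forall h, (forall l, 0 < h l) -> sums_to_one h ->
     weight h x * weight h y = weight h x' * weight h y') ->
  forall l : label T, (label_count x l + label_count y l
    = label_count x' l + label_count y' l)%N.
Proof.
move=> H l0; pose F := floret_lab l0; pose N : R := #|F :\ l0|%:R.
have [x0 [j0 El0]] := labP l0.
have FE : F = floret_of T x0 j0 by apply: floret_labE; rewrite El0 lab_floret_of.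
have l0F : l0 \in F by rewrite FE El0 lab_floret_of.
have N0 : 0 < N.
  rewrite ltr0n; apply/card_gt0P.
  exists (lab T (mix [set j0] x0 (toggle x0)) j0); rewrite !inE FE; apply/andP; split.
    rewrite El0; apply/eqP=> /lab_stage_eq[_]; rewrite mixE set11; apply: toggleP.
  apply/imsetP; exists (mix [set j0] x0 (toggle x0)) => //.
  by rewrite -topredE /= agree_sym agree_mixl // disjoints_subset.
(* The label [l0] gets the value [t], the other labels of its floret share [1 - t]. *)
pose h (t : R) l : R := if l == l0 then t else if l \in F then (1 - t) / N
  else #|floret_lab l|%:R^-1.
have hl0 t : h t l0 = t by rewrite /h eqxx.
have hF t l : l \in F -> l != l0 -> h t l = (1 - t) / N by rewrite /h => -> /negbTE->.
have h_gt0 t : 0 < t < 1 -> forall l, 0 < h t l.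
  move=> /andP[t0 t1] l; rewrite /h; case: ifP => // _; case: ifP => _.
    by rewrite divr_gt0 // subr_gt0.
  rewrite invr_gt0 ltr0n; have [z [j ->]] := labP l.
  by rewrite (floret_labE (lab_floret_of T z j)); apply/card_gt0P; exists (lab T z j);
    apply: lab_floret_of.
have h_sum t : sums_to_one (h t).
  move=> z j; rewrite sum_floret; have [zF|zF] := boolP (l0 \in floret_of T z j).
    have -> : floret_of T z j = F by rewrite -(floret_labE zF).
    rewrite (big_setD1 l0) //= hl0 (eq_bigr (fun=> (1 - t) / N)) => [|l].
      by rewrite sumr_const -mulr_natr -/N divfK ?gt_eqF // addrC subrK.
    by rewrite !inE => /andP[ne lF]; apply: hF.
  have lF l : l \in floret_of T z j -> h t l = #|floret_of T z j|%:R^-1.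
    move=> lz; rewrite /h; case: eqP => [El|_]; first by rewrite -El lz in zF.
    rewrite ifF ?(floret_labE lz) //; apply: contraNF zF => lF.
    by rewrite -(floret_labE lz) (floret_labE (x := x0) (j := j0)) -?FE.
  rewrite (eq_bigr _ lF) sumr_const -[LHS]mulr_natl mulfV // pnatr_eq0 -lt0n.
  by apply/card_gt0P; exists (lab T z j); apply: lab_floret_of.
pose b u v := (\sum_(l in F :\ l0) (label_count u l + label_count v l))%N.
pose C u v : R := (\prod_(l | l \notin F) #|floret_lab l|%:R^-1 ^+ (label_count u l +
  label_count v l))
   * N^-1 ^+ b u v.
have C0 u v : 0 < C u v.
  rewrite mulr_gt0 ?exprn_gt0 ?invr_gt0 // prodr_gt0 // => l _.
  rewrite exprn_gt0 // invr_gt0 ltr0n; have [z [j ->]] := labP l.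
  by rewrite (floret_labE (lab_floret_of T z j)); apply/card_gt0P; exists (lab T z j);
    apply: lab_floret_of.
have wE t u v : weight (h t) u * weight (h t) v
    = C u v * t ^+ (label_count u l0 + label_count v l0) * (1 - t) ^+ b u v.
  rewrite /weight !prod_lab -big_split /=.
  rewrite (eq_bigr (fun l => h t l ^+ (label_count u l + label_count v l))) => [|l _];
    last by rewrite exprD.
  rewrite (bigID (mem F)) /= (big_setD1 l0) //= hl0.
  rewrite (eq_bigr (fun l => ((1 - t) / N) ^+ (label_count u l + label_count v l))) =>
    [|l]; last first.
    by rewrite !inE => /andP[ne lF]; rewrite hF.
  rewrite -expr_sum -/(b u v) expr_div_n mulrC /C.
  rewrite (eq_bigr (fun l => #|floret_lab l|%:R^-1 ^+ (label_count u l + label_count v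
    l))) => [|l lF]; last first.
    rewrite /h ifF ?(negbTE lF) //; apply/eqP=> El; by rewrite El l0F in lF.
  by rewrite exprVn -!mulrA; congr (_ * _); rewrite [RHS]mulrCA; congr (_ * _);
    apply: mulrC.
have E t : 0 < t < 1 ->
    C x y * t ^+ (label_count x l0 + label_count y l0) * (1 - t) ^+ b x y
    = C x' y' * t ^+ (label_count x' l0 + label_count y' l0) * (1 - t) ^+ b x' y'.
  by move=> tP; rewrite -!wE (H (h t) (h_gt0 t tP) (h_sum t)).
apply/eqP; rewrite eqn_leq (monomial_order (C0 x y) (C0 x' y') E).
by rewrite (monomial_order (C0 x' y') (C0 x y) (fun t tP => esym (E t tP))).
Qed.

Lemma ker_psi_binomial_toric x y x' y' (a : label T -> R) :
  ker_psi T (pvar R x * pvar R y - pvar R x' * pvar R y') ->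
  weight a x * weight a y = weight a x' * weight a y' :> R.
Proof.
move=> K; have E := label_count_eq ((@ker_psi_binomial R p d L T x y x' y').1 K).
rewrite /weight !prod_lab -!big_split; apply: eq_bigr => l _ /=.
by rewrite -!exprD E.
Qed.

End Toric.

(** * Balanced trees and the kernel *)

Section Main.
Variables (R : realType) (p : nat) (d : sizes p) (L : finType) (T : cstree d L).
Local Notation RD := {mpoly R[#|{: outcome d}|]}.
Implicit Types (x y z : outcome d) (k j : 'I_p) (D U : {set 'I_p}) (c : poutcome d).

Lemma balanced_ker_sub (I : RD -> Prop) : balanced R T -> ideal_like I ->
  (forall k c D x y, dom c \subset below p k -> k \in D ->
     (forall i, i \in D -> (k <= i)%N) -> (forall m, decides T D c m) ->
     extends c (full_outcome x) -> extends c (full_outcome y) ->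
     ~~ agree (below p k) x y ->
     I (pvar R x * pvar R y - pvar R (mix D x y) * pvar R (mix D y x))) ->
  forall f, ker_psi T f -> I f.
Proof.
move=> bal II swap f kf; apply: (toric_ideal_sub (T := T)) => // [k x y xy nxy|a t a0 t0].
  have [c [ck cP _]] := stage_context T k x.
  have cx : extends c (full_outcome x) by rewrite -cP stage_eq_refl.
  have cy : extends c (full_outcome y) by rewrite -cP.
  have stc u v : extends c (full_outcome u) -> extends c (full_outcome v) ->
    stage_eq T k u v.
    rewrite -!cP => xu xv; apply: stage_eq_trans xv; by rewrite stage_eq_sym.
  have [D [kD Dk dec]] := stage_split bal ck stc.
  exists D; split=> //; first exact: (swap k c).
  exact: decides_swap dec cx cy.
exact: ker_psi_toric.
Qed.

Lemma mix_complement c D x y : extends c (full_outcome x) -> extends c (full_outcome y) ->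
  mix (~: D :\: dom c) x y = mix D y x.
Proof.
move=> cx cy; apply/ffunP=> i; rewrite !mixE in_setD in_setC.
have [ic|_] /= := boolP (i \in dom c); last by case: (i \in D).
by move: cy; rewrite (extends_agree _ cx) => /agreeP/(_ i ic) ->; case: ifP.
Qed.

Lemma saturated_trivial_poly (st : csi d) (f : RD) : saturated st -> trivial_csi st ->
  csi_poly st f -> f = 0.
Proof.
case: st => A B S c /= /eqP sat;
  rewrite /trivial_csi /= => triv [x [y [/= cx cy xyS ->]]].
have xyW : agree (S :|: dom c) x y.
  by rewrite agreeU -(extends_agree _ cx) cy andbT; apply/agreeP.
have mix0 : mix set0 x y = x by apply/ffunP=> i; rewrite mixE inE.
have mixW V : V :|: S :|: dom c = setT -> mix V x y = y.
  move=> VE; apply/ffunP=> i; rewrite mixE; case: ifP => // iV.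
  by apply: (agreeP _ _ _ xyW); have /setP/(_ i) := VE; rewrite -setUA in_setU iV in_setT.
case/orP: triv => /eqP E; rewrite E ?set0U ?setU0 in sat *.
  by rewrite mix0 mixW // mulrC subrr.
by rewrite mix0 mixW // subrr.
Qed.

Section Forward.
Variables (Cs : {set poutcome d}) (G : poutcome d -> rel 'I_p).
Hypothesis dagG : forall c, c \in Cs -> context_dag c (G c).
Hypothesis JG : J_is_union_of_globals T Cs G.

Lemma balanced_ker_sub_sat f : balanced R T -> ker_psi T f ->
  ideal_sum Cs (fun c => @I_Sat R p d c (per (G c))) f.
Proof.
move=> bal; apply: balanced_ker_sub => // [|k c D x y ck kD Dk dec cx cy nxy].
  exact: (@ideal_sum_ideal R p d Cs (fun c => per (G c))).
pose st := Csi D (~: D :\: dom c) set0 c.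
have [i ik xyi] : exists2 i, i \in below p k & x i != y i.
  by move: nxy; rewrite negb_forall_in => /exists_inP.
have ntriv : ~~ trivial_csi st.
  rewrite /trivial_csi /= negb_or; apply/andP; split; apply/set0Pn; first by exists k.
  exists i; rewrite in_setD in_setC; apply/andP; split.
    by apply: contra xyi => ic; move: cy;
      rewrite (extends_agree _ cx) => /agreeP/(_ i ic)->.
  by apply/negP=> /Dk; move: ik; rewrite inE ltnNge => /negbTE->.
have Pwf st' : (exists2 c0, c0 \in Cs & global c0 (G c0) st') -> wf_csi st'.
  by case=> c0 _ [].
have := (JG ntriv).1 (split_derivable ck kD Dk dec).
case/(closure_axiom Pwf) => _ /(_ x cx) [S [c' [[c0 c0C [/= Ec wf sep]] c'x ES]]].
rewrite /= set0U in ES; rewrite -{}Ec in c0C wf sep.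
have dag := dagG c0C.
have cov : D :|: (~: D :\: dom c) :|: S :|: dom c' = setT.
  rewrite -setUA ES; apply/setP=> u; rewrite !(in_setU, in_setD, in_setC, in_setT).
  by case: (u \in D); case: (u \in dom c).
have DS u s : u \in D -> s \in S -> (s < u)%N.
  move=> /Dk ku sS; apply: leq_trans ku.
  have : s \in dom c by rewrite -ES inE sS.
  by move/(subsetP ck); rewrite inE.
have sepper : dsep (per (G c')) D (~: D :\: dom c) S.
  have dagper := per_context_dag dag.
  apply: dsep_of_nonadjacent => //.
  - by case/and4P: wf.
  - by move=> u v /dagper[].
  - move=> u v uv; have vc : v \notin dom c' by case/orP: uv => /dagper[].
    have : v \in D :|: (~: D :\: dom c) :|: S :|: dom c' by rewrite cov inE.
    by rewrite in_setU (negbTE vc) orbF.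
  - apply: (per_nonadjacent dag cov DS) => a b aD bB.
    apply: (dsep_nonadjacent sep) => //.
    by apply: contraTneq bB => <-; rewrite in_setD in_setC aD andbF.
apply: (ideal_sum_incl (G := fun c => per (G c)) (st := Csi D (~: D :\: dom c) S c') c0C).
  by split; [split|apply/eqP].
have agr u : u \in dom c -> x u = y u.
  by move: cy; rewrite (extends_agree _ cx) => /agreeP; apply.
exists x, y; split=> //=.
- rewrite (extends_agree _ c'x); apply/agreeP=> u uc; apply: agr.
  by rewrite -ES inE uc orbT.
- by move=> u uS; apply: agr; rewrite -ES inE uS.
- by rewrite (mix_complement _ cx cy) mulrC [X in _ = _ - X]mulrC mulrC.
Qed.

Lemma sat_sub_ker f : ideal_sum Cs (fun c => @I_Sat R p d c (per (G c))) f -> ker_psi T f.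
Proof.
apply: (ideal_sum_sub (G := fun c => per (G c)) (ker_psi_ideal R T)) =>
  c st u cC [[Ec wf sep] sat] stu.
have [triv|ntriv] := boolP (trivial_csi st).
  by rewrite (saturated_trivial_poly sat triv stu); apply: (ker_psi_ideal R T).1.
apply: J_saturated_ker sat stu; apply/(JG ntriv); apply: sac_axiom; exists c => //.
split=> //; apply: dsep_sub sep; first exact: iter_dm_sub.
by move=> v w /(per_context_dag (dagG cC))[].
Qed.

Lemma ker_sat_balanced :
  (forall f, ker_psi T f <-> ideal_sum Cs (fun c => @I_Sat R p d c (per (G c))) f) ->
  balanced R T.
Proof.
move=> kerE; apply/balancedP=> k x y xy; set x' := mix _ x y; set y' := mix _ y x.
pose s u : RD := \sum_(v | agree (below p k.+1) u v) pvar R v.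
have sE (q : outcome d -> R) u : oeval q (s u) = marginal q (below p k.+1) u.
  by rewrite rmorph_sum; apply: eq_bigr => v _; rewrite oeval_pvar.
have below_x' : agree (below p k) x' x by apply: agree_mixl; apply: disjoint_below_set1.
have below_y' : agree (below p k) y' y by apply: agree_mixl; apply: disjoint_below_set1.
have lab_x' : lab T x' k = lab T y k.
  apply: stage_eq_lab; last by rewrite mixE set11.
  by apply: stage_eq_trans xy; apply: agree_stage_eq.
have lab_y' : lab T y' k = lab T x k.
  apply: stage_eq_lab; last by rewrite mixE set11.
  by apply: (@stage_eq_trans _ _ _ _ _ _ y); [apply: agree_stage_eq|rewrite stage_eq_sym].
have ker_f : ker_psi T (s x * s y - s x' * s y').
  apply/ker_psiP=> h t h0 h1 t0; rewrite rmorphB !rmorphM !sE.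
  have mE u : marginal (scaled t h) (below p k.+1) u
      = t * (h (lab T u k) * marginal (weight h) (below p k) u).
    by rewrite -marginal_belowS // /marginal mulr_sumr.
  rewrite !mE lab_x' lab_y' (marginal_agree _ below_x') (marginal_agree _ below_y').
  ring.
have toric (a : label T -> R) : oeval (weight a) (s x * s y - s x' * s y') = 0.
  move/kerE: ker_f; apply: (ideal_sum_sub (G := fun c =>
    per (G c)) (eval_ideal (oeval (weight a)))).
  move=> c st u cC Sst stu.
  have : ker_psi T u.
    by apply/kerE; apply: (ideal_sum_incl (G := fun c => per (G c)) cC Sst stu).
  case: stu => z [w [_ _ _ ->]] /ker_psi_binomial_toric Ea.
  by rewrite rmorphB !rmorphM !oeval_pvar Ea subrr.
apply/eqP; rewrite -subr_eq0; apply/eqP.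
apply: (mpoly_eq0_itv (ltr01 : 0 < (1 : R))) => h h0; pose a l := h (enum_rank l).
have a0 l : 0 < a l by case/andP: (h0 (enum_rank l)).
transitivity (leval a (tpoly_at R T k.+1 x * tpoly_at R T k.+1 y - tpoly_at R T k.+1 x'
  * tpoly_at R T k.+1 y')).
  by apply: meval_eq => i; rewrite /a enum_valK.
have := toric a; rewrite !rmorphB !rmorphM !sE !marginal_below !prod_belowS lab_x' lab_y'.
pose P u := \prod_(j : 'I_p | (j < k)%N) a (lab T u j).
have PE u v : agree (below p k) u v -> P u = P v.
  move=> uv; apply: eq_bigr => j jk; congr a; apply: lab_agree.
  by apply: agree_sub uv; apply: below_subset.
rewrite -!/(P _) (PE _ _ below_x') (PE _ _ below_y').
have n0 : a (lab T x k) * a (lab T y k) * (P x * P y) != 0.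
  by rewrite !mulf_neq0 ?gt_eqF // prodr_gt0.
move=> E; apply: (mulfI n0); rewrite mulr0 -[RHS]E.
ring.
Qed.

End Forward.

Section ContextPartition.
Variable c : poutcome d.

Definition splits U : Prop :=
  forall x y, extends c (full_outcome x) -> extends c (full_outcome y) ->
    path_monomial R T x * path_monomial R T y
    = path_monomial R T (mix U x y) * path_monomial R T (mix U y x).

Lemma splitsT : splits setT.
Proof.
have E x y : mix setT x y = y by apply/ffunP=> i; rewrite mixE inE.
by move=> x y _ _; rewrite !E mulrC.
Qed.

Lemma splitsC U : splits U -> splits (~: U).
Proof.
have E x y : mix (~: U) x y = mix U y x by apply/ffunP=> i; rewrite !mixE in_setC;
  case: (i \in U).
by move=> sU x y cx cy; rewrite !E sU // mulrC.
Qed.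

(* Swap [U :&: V] between [x] and [y] through the intermediate outcome that is
   [x] on [U] and [y] elsewhere. *)
Lemma splitsI U V : splits U -> splits V -> splits (U :&: V).
Proof.
move=> sU sV x y cx cy; set E := U :&: V.
pose z := mix U y x; pose z1 := mix E z y.
have cz : extends c (full_outcome z) by apply: extends_mix.
have cz1 : extends c (full_outcome z1) by apply: extends_mix.
have H1 := sU x z1 cx cz1; have H2 := sV z y cz cy.
have e1 : mix U x z1 = mix E x y.
  by apply/ffunP=> i; rewrite !mixE in_setI; case: (i \in U); case: (i \in V).
have e2 : mix U z1 x = z.
  by apply/ffunP=> i; rewrite !mixE in_setI; case: (i \in U); case: (i \in V).
have e3 : mix V z y = z1.
  by apply/ffunP=> i; rewrite !mixE in_setI; case: (i \in U); case: (i \in V).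
have e4 : mix V y z = mix E y x.
  by apply/ffunP=> i; rewrite !mixE in_setI; case: (i \in U); case: (i \in V).
rewrite e1 e2 in H1; rewrite e3 e4 in H2.
apply: (mulIf (mulf_neq0 (path_monomial_neq0 R T z) (path_monomial_neq0 R T z1))).
have := congr2 *%R H1 H2; rewrite /= => H.
transitivity (path_monomial R T x * path_monomial R T z1 * (path_monomial R T z *
  path_monomial R T y)).
  by ring.
by rewrite H; ring.
Qed.

Lemma splits_dom U V : U :\: dom c = V :\: dom c -> splits U -> splits V.
Proof.
move=> UV sU x y cx cy.
have E u v : extends c (full_outcome u) -> extends c (full_outcome v) ->
  mix V u v = mix U u v.
  move=> cu cv; apply/ffunP=> i; rewrite !mixE; have /setP/(_ i) := UV; rewrite !in_setD.
  have [ic _|_ /= ->//] := boolP (i \in dom c).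
  by move: cv; rewrite (extends_agree _ cu) => /agreeP/(_ i ic) ->; rewrite !if_same.
by rewrite !E // sU.
Qed.

Definition inseparable : rel 'I_p := fun u v =>
  `[< forall U, splits U -> (u \in U) = (v \in U) >].

Lemma inseparableP u v : reflect (forall U, splits U ->
  (u \in U) = (v \in U)) (inseparable u v).
Proof. exact: asboolP. Qed.

Lemma inseparable_trans u v w : inseparable u w -> inseparable v w -> inseparable u v.
Proof.
by move=> /inseparableP uw /inseparableP vw; apply/inseparableP=> U sU; rewrite uw // vw.
Qed.

Lemma splits_closed U :
  (forall u v, u \notin dom c -> v \notin dom c -> inseparable u v ->
     u \in U -> v \in U) -> splits U.
Proof.
move=> clU; pose atom u := \bigcap_(V | `[< splits V >] && (u \in V)) V.
have atom_splits u : splits (atom u).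
  apply: (big_ind splits) => [||V /andP[/asboolP]]; [exact: splitsT|exact: splitsI|by []].
have atomP u v : v \in atom u -> inseparable u v.
  move=> /bigcapP av; apply/inseparableP=> V sV.
  apply/idP/idP => [uV|vV]; first by apply: av; rewrite uV andbT; apply/asboolP.
  apply: contraT => uV; have := av (~: V); rewrite !inE uV vV andbT.
  by move=> /(_ (introT (asboolP _) (splitsC sV))).
have splitsU V W : splits V -> splits W -> splits (V :|: W).
  by move=> sV sW; rewrite -[_ :|: _]setCK setCU; apply: splitsC; apply: splitsI;
    apply: splitsC.
have splits0 : splits set0 by rewrite -setCT; apply: splitsC; apply: splitsT.
apply: (@splits_dom (\bigcup_(u in U :\: dom c) atom u)); last first.
  by apply: (big_ind splits) => // u _; apply: atom_splits.
apply/setP=> v; rewrite !in_setD; have [//|vc] /= := boolP (v \in dom c).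
apply/bigcupP/idP => [[u]|vU]; last first.
  exists v; first by rewrite in_setD vc.
  by apply/bigcapP=> V /andP[].
by rewrite in_setD => /andP[uc uU] /atomP uv; apply: clU uv uU.
Qed.

Definition partition_dag : rel 'I_p := fun u v =>
  [&& (u < v)%N, u \notin dom c, v \notin dom c & inseparable u v].

Lemma partition_context_dag : context_dag c partition_dag.
Proof. by move=> u v /and4P[]. Qed.

Lemma partition_perfect : perfect partition_dag.
Proof.
move=> u v w /and4P[_ uc _ uw] /and4P[_ vc _ vw] uv.
rewrite /adjacent /partition_dag uc vc (inseparable_trans uw vw) (inseparable_trans vw
  uw) !andbT.
by rewrite -neq_ltn val_eqE.
Qed.

Lemma partition_sat_swap (st : csi d) x y : Sat c partition_dag st ->
  extends c (full_outcome x) -> extends c (full_outcome y) ->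
  {in cond st, forall i, x i = y i} ->
  path_monomial R T x * path_monomial R T y
  = path_monomial R T (mix (rhs st) x y) * path_monomial R T (mix (lhs st) x y).
Proof.
case: st => A B S c' [[/= -> wf sep] /eqP/= sat] cx cy xyS.
have xyW : agree (S :|: dom c) x y.
  by rewrite agreeU -(extends_agree _ cx) cy andbT; apply/agreeP.
pose U := [set v | (v \notin dom c) && [exists u in A, inseparable u v]].
have /wf_csiP wfi := wf.
have UB v : v \in U -> v \notin B.
  rewrite inE => /andP[vc /exists_inP[u uA uv]]; apply/negP=> vB.
  have uc : u \notin dom c by have := wfi u; rewrite uA; do ![case: (_ \in _)].
  have une : u != v by apply: contraTneq (wfi v) => Ev; rewrite -Ev uA Ev vB;
    do ![case: (_ \in _)].
  have := dsep_nonadjacent sep uA vB une; rewrite /adjacent /partition_dag uc vc uv.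
  have vu : inseparable v u by apply/inseparableP=> V sV; move/inseparableP: uv => ->.
  by rewrite vu !andbT -neq_ltn val_eqE une.
have AU u : u \in A -> u \in U.
  move=> uA; have uc : u \notin dom c by have := wfi u; rewrite uA; do ![case: (_ \in _)].
  by rewrite in_set uc; apply/exists_inP; exists u => //; apply/inseparableP.
have sU : splits U.
  apply: splits_closed => u v uc vc uv;
    rewrite ![_ \in U]in_set uc vc => /exists_inP[w wA wu].
  apply/exists_inP; exists w => //; apply: inseparable_trans wu _.
  by apply/inseparableP=> V sV; move/inseparableP: uv => ->.
have cover i : i \notin A -> i \notin B -> x i = y i.
  move=> iA iB; apply: (agreeP _ _ _ xyW); have /setP/(_ i) := sat.
  by rewrite -setUA !in_setU (negbTE iA) (negbTE iB) in_setT.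
have dAB : [disjoint A & B] by case/and4P: wf.
have -> : mix A x y = mix U x y.
  apply/ffunP=> i; rewrite !mixE; have [/AU->//|iA] := boolP (i \in A).
  by case: ifP => // /UB iB; rewrite cover.
have -> : mix B x y = mix U y x.
  apply/ffunP=> i; rewrite !mixE; have [iB|iB] := boolP (i \in B).
    by case: ifP => // /UB; rewrite iB.
  by case: ifP => // /negbT iU; rewrite cover //; apply: contra iU; apply: AU.
by rewrite sU // mulrC.
Qed.

End ContextPartition.

Lemma balanced_ker_partition f : balanced R T ->
  ker_psi T f <-> ideal_sum setT (fun c => @I_Sat R p d c (partition_dag c)) f.
Proof.
move=> bal; split; last first.
  apply: (ideal_sum_sub (G := partition_dag) (ker_psi_ideal R T)) => c st u _ Sst.
  case=> x [y [cx cy xyS ->]]; apply/ker_psi_binomial=> h h0 h1.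
  have Ec : ctx st = c by case: Sst => -[].
  rewrite Ec in cx cy.
  have := congr1 (leval h) (partition_sat_swap Sst cx cy xyS).
  by rewrite !rmorphM !leval_path_monomial.
apply: balanced_ker_sub => // [|k c D x y ck kD Dk dec cx cy _].
  exact: (@ideal_sum_ideal R p d setT partition_dag).
pose st := Csi D (~: D :\: dom c) set0 c.
have sD : splits c D by move=> u v cu cv; apply: decides_swap dec cu cv.
have dDc : [disjoint D & dom c].
  apply/disjoint_pointwise=> i; apply/negP=> /andP[/Dk ki /(subsetP ck)].
  by rewrite inE ltnNge ki.
have wf : wf_csi st.
  apply/wf_csiP=> i; move/disjoint_pointwise/(_ i): dDc; rewrite in_setD in_setC in_set0.
  by case: (i \in D); case: (i \in dom c).
apply: (ideal_sum_incl (st := st) (in_setT c)).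
  split; last by apply/eqP/setP=> i; rewrite /= !(in_setU, in_setD, in_setC, in_setT);
    case: (i \in D); case: (i \in dom c); rewrite ?orbT.
  split=> //=; have dag := @partition_context_dag c; apply: dsep_of_nonadjacent.
  - by case/and4P: wf.
  - by move=> u v /dag[].
  - move=> u v uv; have vc : v \notin dom c by case/orP: uv => /dag[].
    by rewrite setU0 in_setU in_setD in_setC vc; case: (v \in D).
  - by move=> i s _; rewrite inE.
  - move=> a b aD; rewrite in_setD in_setC => /andP[_ bD];
    apply/negP=> /orP[] /and4P[_ _ _ /inseparableP/(_ _ sD)];
    by rewrite aD (negbTE bD).
exists x, y; split=> //=; first by move=> i; rewrite inE.
by rewrite (mix_complement _ cx cy) [X in _ = _ - X]mulrC.
Qed.

End Main.

Theorem theorem5p13 (R : realType) (p : nat) (d : sizes p) (L : finType)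
    (T : cstree d L) :
  (forall (Cs : {set poutcome d}) (G : poutcome d -> rel 'I_p),
     (forall c, c \in Cs -> context_dag c (G c)) ->
     J_is_union_of_globals T Cs G ->
     (balanced R T <->
      (forall f : outcome_ring R d,
         ker_psi T f <-> ideal_sum Cs (fun c => @I_Sat R p d c (per (G c))) f)))
  /\
  (balanced R T ->
   exists (Cs : {set poutcome d}) (H : poutcome d -> rel 'I_p),
     (forall c, c \in Cs -> context_dag c (H c) /\ perfect (H c)) /\
     (forall f : outcome_ring R d,
        ker_psi T f <-> ideal_sum Cs (fun c => @I_Sat R p d c (H c)) f)).
Proof.
split=> [Cs G dagG JG|bal].
  split=> [bal f|]; last exact: ker_sat_balanced.
  by split; [apply: balanced_ker_sub_sat|apply: sat_sub_ker].
exists setT, (partition_dag R T); split=> [c _|f]; last exact: balanced_ker_partition.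
by split; [apply: partition_context_dag|apply: partition_perfect].
Qed.
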